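(* For any $\alpha<1$ there exist constants $0<\varepsilon_0<\varepsilon_1<1$ such that for any $k=k(n)\le\alpha n$, any non-adaptive $(\varepsilon_0,\varepsilon_1)$-tolerant $k$-junta tester for functions $f\colon\{0,1\}^n\to\{0,1\}$ must make $\widetilde{\Omega}(k^2)$ queries.
   Context: For $f,g\colon\{0,1\}^n\to\{0,1\}$, $\mathrm{dist}(f,g)=\Pr_{\boldsymbol x\sim\{0,1\}^n}[f(\boldsymbol x)\neq g(\boldsymbol x)]$ ($\boldsymbol x$ uniform), and for a class $\mathcal P$ of functions $\mathrm{dist}(f,\mathcal P)=\min_{g\in\mathcal P}\mathrm{dist}(f,g)$. A function is a $k$-junta if it depends on at most $k$ of its variables. An $(\varepsilon_0,\varepsilon_1)$-tolerant tester for $\mathcal P$, given black-box query access to $f$, accepts with probability at least $2/3$ if $\mathrm{dist}(f,\mathcal P)\le\varepsilon_0$ and rejects with probability at least $2/3$ if $\mathrm{dist}(f,\mathcal P)>\varepsilon_1$. Non-adaptive means all queries are chosen before any answers are seen. $\widetilde{\Omega}(f)$ means $\Omega(f/\log^c f)$ for an absolute constant $c$. *)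

(* Defs.v *)
From mathcomp Require Import all_boot all_order all_algebra.
From mathcomp Require Import reals exp.
Set Implicit Arguments.
Unset Strict Implicit.
Unset Printing Implicit Defensive.
Import Order.TTheory GRing.Theory Num.Theory.
Local Open Scope ring_scope.

Definition cube (n : nat) : finType := {ffun 'I_n -> bool}.

Definition boolfun (n : nat) : finType := {ffun cube n -> bool}.

Definition dist (R : realType) (n : nat) (f g : boolfun n) : R :=
  #|[set x : cube n | f x != g x]|%:R / #|cube n|%:R.

(* Distances never exceed 1, so the neutral value 1 does not affect the minimum
   over a nonempty class. *)
Definition dist_class (R : realType) (n : nat) (f : boolfun n)
    (P : {set boolfun n}) : R :=
  \big[Num.min/1]_(g in P) dist R f g.

Definition flip (n : nat) (i : 'I_n) (x : cube n) : cube n :=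
  [ffun j => if j == i then ~~ x j else x j].

Definition depends_on (n : nat) (f : boolfun n) (i : 'I_n) : bool :=
  [exists x : cube n, f (flip i x) != f x].

Definition juntas (n k : nat) : {set boolfun n} :=
  [set f : boolfun n | (#|[set i : 'I_n | depends_on f i]| <= k)%N].

(* A randomized non-adaptive algorithm making (at most, by repeating a query)
   q queries: all queries are a function of the random seed alone, and the
   verdict is a function of the seed and of the q answers. A finite seed space
   with arbitrary real weights loses no generality, since for fixed n and q
   there are only finitely many deterministic non-adaptive algorithms. *)
Record nonadaptive_tester (R : realType) (n q : nat) := NonadaptiveTester {
  seed : finType;
  seed_pr : seed -> R;
  seed_pr_ge0 : forall s, 0 <= seed_pr s;
  seed_pr_sum1 : \sum_s seed_pr s = 1;
  queries : seed -> q.-tuple (cube n);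
  verdict : seed -> q.-tuple bool -> bool
}.

Definition accepts (R : realType) (n q : nat) (T : nonadaptive_tester R n q)
    (f : boolfun n) (s : seed T) : bool :=
  verdict s (map_tuple f (queries s)).

Definition accept_pr (R : realType) (n q : nat) (T : nonadaptive_tester R n q)
    (f : boolfun n) : R :=
  \sum_(s : seed T | accepts f s) seed_pr s.

Definition reject_pr (R : realType) (n q : nat) (T : nonadaptive_tester R n q)
    (f : boolfun n) : R :=
  \sum_(s : seed T | ~~ accepts f s) seed_pr s.

Definition is_tolerant_tester (R : realType) (n q : nat) (eps0 eps1 : R)
    (P : {set boolfun n}) (T : nonadaptive_tester R n q) : Prop :=
  forall f : boolfun n,
    (dist_class R f P <= eps0 -> 2%:R / 3%:R <= accept_pr T f) /\
    (eps1 < dist_class R f P -> 2%:R / 3%:R <= reject_pr T f).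

(* x / log^c x, the rate in soft-Omega bounds. The truncation of the logarithm
   at 1 only keeps the denominator positive when x is small; it is inactive for
   x >= exp 1, in particular for x = k ^ 2 with k >= 2. *)
Definition over_polylog (R : realType) (c : nat) (x : R) : R :=
  x / (Num.max 1 (ln x)) ^+ c.

(* Main.v *)
Require Import Defs.
From mathcomp Require Import all_boot all_order all_algebra.
From mathcomp Require Import reals exp.
From mathcomp Require Import zify ring lra.
Set Implicit Arguments.
Unset Strict Implicit.
Unset Printing Implicit Defensive.
Import Order.TTheory GRing.Theory Num.Theory.
Local Open Scope ring_scope.
Local Notation expR := sequences.expR.

(** Split most of the coordinates into [h] blocks of [B] pairs each. A
    random pair of every block is "active" and all other coordinates of the
    blocks are "control"; the control part of [x] selects a random gate,
    that is, the XOR of two active coordinates and a random bit. Each active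
    pair has one coordinate on either of two sides, chosen by a random sign.
    In the YES distribution the two inputs of a gate lie on the same side,
    in the NO distribution on opposite sides. Forgetting the worse side
    makes a YES function 1/4-close to a junta. A junta on [k], about
    (2B-1)h, coordinates either forgets many control coordinates, which
    decorrelates it from a NO function, or forgets about half of the active
    ones, and then about 3/4 of the NO gates read a forgotten input.

    Queries falling in one control cell differ in few blocks, for otherwise
    the random choice of the active pairs separates them. A gate can be
    informative only if both its inputs lie in the set L_z of blocks on
    which the queries of its cell z disagree. Expanding the likelihoods in
    the random signs, the two acceptance probabilities differ by at most
      2 (E prod_z (1 + (sum_(b in L_z) sigma_b)^2 / h^2) - 1),
    and the exponent (1/h^2) sum_z (sum_(b in L_z) sigma_b)^2 has mean sum_z
    |L_z| / h^2 = O(q log k / k^2) and subexponential tails. *)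

(** * Probability mass functions on finite types *)

Record pmf (R : numDomainType) (T : finType) := Pmf {
  pmf_val :> T -> R;
  pmf_ge0 : forall t, 0 <= pmf_val t;
  pmf_sum1 : \sum_t pmf_val t = 1
}.

Definition expect (R : numDomainType) (T : finType) (mu : pmf R T)
  (f : T -> R) : R := \sum_t mu t * f t.

Definition prob (R : numDomainType) (T : finType) (mu : pmf R T)
  (A : pred T) : R := \sum_(t | A t) mu t.

Local Notation "\E_ ( t ~ mu ) F" := (expect mu (fun t => F))
  (at level 41, t name, F at level 41, format "\E_ ( t  ~  mu )  F").
Local Notation "\P_ ( t ~ mu ) A" := (prob mu (fun t => A))
  (at level 41, t name, A at level 41, format "\P_ ( t  ~  mu )  A").

Section Expectation.
Variables (R : realFieldType) (T : finType) (mu : pmf R T).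
Implicit Types (f g : T -> R) (A B : pred T).

Lemma eq_expect f g : f =1 g -> expect mu f = expect mu g.
Proof. by move=> fg; apply: eq_bigr => t _; rewrite fg. Qed.

Lemma expect_cst c : \E_(_ ~ mu) c = c.
Proof. by rewrite /expect -mulr_suml pmf_sum1 mul1r. Qed.

Lemma expectD f g : \E_(t ~ mu) (f t + g t) = expect mu f + expect mu g.
Proof. by rewrite -big_split; apply: eq_bigr => t _; rewrite mulrDr. Qed.

Lemma expectZl c f : \E_(t ~ mu) (c * f t) = c * expect mu f.
Proof. by rewrite mulr_sumr; apply: eq_bigr => t _; rewrite mulrCA. Qed.

Lemma expectB f g : \E_(t ~ mu) (f t - g t) = expect mu f - expect mu g.
Proof. by rewrite -sumrB; apply: eq_bigr => t _; rewrite mulrBr. Qed.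

Lemma expect_sum (I : finType) (P : pred I) (F : I -> T -> R) :
  \E_(t ~ mu) (\sum_(i | P i) F i t) = \sum_(i | P i) expect mu (F i).
Proof.
by rewrite exchange_big; apply: eq_bigr => t _; rewrite mulr_sumr.
Qed.

Lemma le_expect f g :
  (forall t, mu t != 0 -> f t <= g t) -> expect mu f <= expect mu g.
Proof.
move=> fg; apply: ler_sum => t _.
have [->|mut_neq0] := eqVneq (mu t) 0; first by rewrite !mul0r.
by apply: ler_wpM2l; [exact: pmf_ge0|exact: fg].
Qed.

Lemma norm_expect_le f : `|expect mu f| <= \E_(t ~ mu) `|f t|.
Proof.
apply: le_trans (ler_norm_sum _ _ _) _; apply: ler_sum => t _.
by rewrite normrM (ger0_norm (pmf_ge0 mu t)).
Qed.

Lemma sqr_expect_le f : expect mu f ^+ 2 <= \E_(t ~ mu) f t ^+ 2.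
Proof.
set m := expect mu f; rewrite -subr_ge0.
have -> : \E_(t ~ mu) f t ^+ 2 - m ^+ 2 = \E_(t ~ mu) (f t - m) ^+ 2.
  transitivity (\E_(t ~ mu) (f t ^+ 2 - (2 * m * f t - m ^+ 2))).
    by rewrite !expectB expectZl expect_cst -/m; ring.
  by apply: eq_expect => t; ring.
by apply: sumr_ge0 => t _; rewrite mulr_ge0 ?pmf_ge0 ?sqr_ge0.
Qed.

Lemma probE A : prob mu A = \E_(t ~ mu) (A t)%:R.
Proof.
by rewrite /prob big_mkcond; apply: eq_bigr => t _; rewrite mulr_natr mulrb.
Qed.

Lemma prob_ge0 A : 0 <= prob mu A.
Proof. by apply: sumr_ge0 => t _; exact: pmf_ge0. Qed.

Lemma probC A : \P_(t ~ mu) ~~ A t = 1 - prob mu A.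
Proof.
by apply/esym/eqP; rewrite subr_eq addrC -(pmf_sum1 mu) [X in X == _](bigID A).
Qed.

Lemma prob_le1 A : prob mu A <= 1.
Proof. by have := prob_ge0 (predC A); rewrite probC subr_ge0. Qed.

Lemma le_prob A B : (forall t, A t -> B t) -> prob mu A <= prob mu B.
Proof.
move=> AB; rewrite !probE; apply: le_expect => t _.
by case: (A t) (AB t) => [->|].
Qed.

Lemma prob_union_le (I : finType) (A : pred T) (B : I -> pred T) :
  (forall t, A t -> exists i, B i t) -> prob mu A <= \sum_i prob mu (B i).
Proof.
move=> AB; rewrite (eq_bigr _ (fun i _ => probE (B i))) -expect_sum probE.
apply: le_expect => t _.
case: (boolP (A t)) => [/AB[i Bi]|_]; last exact: sumr_ge0.
by rewrite (bigD1 i) //= Bi lerDl sumr_ge0.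
Qed.

Lemma prob_or_le A B : \P_(t ~ mu) (A t || B t) <= prob mu A + prob mu B.
Proof.
rewrite !probE -expectD; apply: le_expect => t _.
by case: (A t); case: (B t); rewrite /= ?addr0 ?add0r ?lerDl.
Qed.

Lemma markov_sqr f (eps : R) : 0 < eps ->
  \P_(t ~ mu) (eps <= `|f t|) <= (\E_(t ~ mu) f t ^+ 2) / eps ^+ 2.
Proof.
move=> eps_gt0; rewrite ler_pdivlMr ?exprn_gt0 //.
rewrite mulrC probE -(expectZl (eps ^+ 2)).
apply: le_expect => t _.
have [le_f|_] := boolP (eps <= _); last by rewrite mulr0 sqr_ge0.
rewrite mulr1 -[leRHS]real_normK ?num_real //.
by rewrite ler_pXn2r // nnegrE ltW.
Qed.

End Expectation.

Lemma exchange_expect (R : realFieldType) (T U : finType) (mu : pmf R T)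
    (nu : pmf R U) (F : T -> U -> R) :
  \E_(t ~ mu) \E_(u ~ nu) F t u = \E_(u ~ nu) \E_(t ~ mu) F t u.
Proof.
rewrite /expect; under eq_bigr do rewrite mulr_sumr.
rewrite exchange_big; apply: eq_bigr => u _; rewrite mulr_sumr.
by apply: eq_bigr => t _; rewrite mulrCA.
Qed.

Lemma sqr_expectE (R : realFieldType) (T : finType) (mu : pmf R T)
    (f : T -> R) :
  expect mu f ^+ 2 = \E_(t ~ mu) \E_(u ~ mu) (f t * f u).
Proof.
under [RHS]eq_expect do rewrite expectZl mulrC.
by rewrite expectZl expr2.
Qed.

Lemma chebyshev_sparse (R : realFieldType) (X T : finType) (nu : pmf R X)
    (mu : pmf R T) (Z : X -> T -> R) (near : rel X) (kappa eps : R) :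
  (forall x t, `|Z x t| <= 1) ->
  (forall x y, ~~ near x y -> \E_(t ~ mu) (Z x t * Z y t) = 0) ->
  (forall x, prob nu (near x) <= kappa) -> 0 < eps ->
  \P_(t ~ mu) (eps <= `|\E_(x ~ nu) Z x t|) <= kappa / eps ^+ 2.
Proof.
move=> Z_le1 far near_le eps_gt0.
apply: le_trans (markov_sqr _ _ eps_gt0) _.
rewrite ler_wpM2r ?invr_ge0 ?sqr_ge0 //.
have -> : \E_(t ~ mu) (\E_(x ~ nu) Z x t) ^+ 2 =
    \E_(x ~ nu) \E_(y ~ nu) \E_(t ~ mu) (Z x t * Z y t).
  under eq_expect do rewrite sqr_expectE.
  by rewrite exchange_expect; apply: eq_expect => x; rewrite exchange_expect.
rewrite -[leRHS](expect_cst nu); apply: le_expect => x _.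
apply: le_trans (near_le x); rewrite probE; apply: le_expect => y _.
have [xy|/far -> //] := boolP (near x y).
rewrite -[leRHS](expect_cst mu); apply: le_expect => t _.
by apply: le_trans (ler_norm _) _; rewrite normrM mulr_ile1.
Qed.

Section Uniform.
Variables (R : realFieldType) (T : finType) (T_gt0 : (0 < #|T|)%N).

Lemma natr_card_gt0 : 0 < #|T|%:R :> R. Proof. by rewrite ltr0n. Qed.

Lemma sum_invr_card : \sum_(t : T) #|T|%:R^-1 = 1 :> R.
Proof.
by rewrite sumr_const -[LHS]mulr_natr mulVf // gt_eqF // natr_card_gt0.
Qed.

Lemma invr_card_ge0 : 0 <= #|T|%:R^-1 :> R. Proof. by rewrite invr_ge0. Qed.

Definition uniform : pmf R T :=
  @Pmf R T (fun=> #|T|%:R^-1) (fun=> invr_card_ge0) sum_invr_card.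

Lemma expect_uniform (f : T -> R) : expect uniform f = (\sum_t f t) / #|T|%:R.
Proof. by rewrite /expect -mulr_sumr mulrC. Qed.

Lemma prob_uniform (A : pred T) : prob uniform A = #|A|%:R / #|T|%:R.
Proof. by rewrite /prob sumr_const -[LHS]mulr_natl. Qed.

Lemma expect_uniform_inj (h : T -> T) (f : T -> R) :
  injective h -> \E_(t ~ uniform) f (h t) = expect uniform f.
Proof.
by move=> h_inj; rewrite !expect_uniform [in RHS](reindex_inj h_inj).
Qed.

End Uniform.

Section ProductLaw.
Variables (R : realFieldType) (I D : finType).
Implicit Types mu : I -> pmf R D.

Lemma prod_pmf_ge0 mu (G : {ffun I -> D}) : 0 <= \prod_i mu i (G i).
Proof. by apply: prodr_ge0 => i _; exact: pmf_ge0. Qed.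

Lemma prod_pmf_sum1 mu : \sum_(G : {ffun I -> D}) \prod_i mu i (G i) = 1.
Proof.
rewrite -(bigA_distr_bigA (fun i d => mu i d)) big1 // => i _.
exact: pmf_sum1.
Qed.

Definition prod_pmf mu : pmf R {ffun I -> D} :=
  Pmf (prod_pmf_ge0 mu) (prod_pmf_sum1 mu).

Lemma expect_prod_pmf mu (f : I -> D -> R) :
  \E_(G ~ prod_pmf mu) \prod_i f i (G i) = \prod_i expect (mu i) (f i).
Proof.
by rewrite bigA_distr_bigA; apply: eq_bigr => G _; rewrite -big_split.
Qed.

Lemma expect_prod_pmf_keyed mu (X : Type) (key : X -> I) (f : X -> D -> R)
    (s : seq X) :
  \E_(G ~ prod_pmf mu) \prod_(x <- s) f x (G (key x)) =
  \prod_i \E_(d ~ mu i) \prod_(x <- s | key x == i) f x d.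
Proof.
rewrite -expect_prod_pmf; apply: eq_expect => G.
rewrite [RHS](exchange_big_dep xpredT) //=; apply: eq_bigr => x _.
by rewrite (big_pred1 (key x)) // => i; rewrite eq_sym.
Qed.

Lemma expect_prod_pmf_keyed_eq0 mu (X : Type) (key : X -> I) (f : X -> D -> R)
    (s : seq X) i :
  \E_(d ~ mu i) \prod_(x <- s | key x == i) f x d = 0 ->
  \E_(G ~ prod_pmf mu) \prod_(x <- s) f x (G (key x)) = 0.
Proof.
by move=> i_mean0; rewrite expect_prod_pmf_keyed (bigD1 i) //= i_mean0 mul0r.
Qed.

Lemma expect_uniform_ffun (D_gt0 : (0 < #|D|)%N)
    (ID_gt0 : (0 < #|{ffun I -> D}|)%N) (f : {ffun I -> D} -> R) :
  expect (uniform R ID_gt0) f = expect (prod_pmf (fun=> uniform R D_gt0)) f.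
Proof.
apply: eq_bigr => G _; congr (_ * _).
by rewrite /= prodr_const card_ffun natrX exprVn.
Qed.

Lemma eq_sum_ffun_prod_fiber (E : finType) (pi : I -> D -> E)
    (v w : I -> D -> R) (Phi : {ffun I -> E} -> R) :
  (forall i e, \sum_(d | pi i d == e) v i d = \sum_(d | pi i d == e) w i d) ->
  \sum_(G : {ffun I -> D}) (\prod_i v i (G i)) * Phi [ffun i => pi i (G i)] =
  \sum_(G : {ffun I -> D}) (\prod_i w i (G i)) * Phi [ffun i => pi i (G i)].
Proof.
move=> vw_fiber.
have fiberwise u : \sum_(G : {ffun I -> D})
      (\prod_i u i (G i)) * Phi [ffun i => pi i (G i)] =
    \sum_(r : {ffun I -> E}) (\prod_i \sum_(d | pi i d == r i) u i d) * Phi r.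
  rewrite (partition_big
    (fun G : {ffun I -> D} => [ffun i => pi i (G i)]) xpredT) //=.
  apply: eq_bigr => r _; rewrite bigA_distr_big_dep mulr_suml.
  apply: eq_big => [G|G /eqP -> //].
  apply/eqP/familyP => [<- i|eG]; first by rewrite ffunE unfold_in /=.
  by apply/ffunP => i; rewrite ffunE; apply/eqP; exact: eG.
by rewrite !fiberwise; apply: eq_bigr => r _; congr (_ * _); apply: eq_bigr.
Qed.

End ProductLaw.

Section DependentPair.
Variables (R : realFieldType) (T U : finType).
Variables (mu : pmf R T) (nu : T -> pmf R U).

Lemma dpair_pmf_ge0 (p : T * U) : 0 <= mu p.1 * nu p.1 p.2.
Proof. by rewrite mulr_ge0 ?pmf_ge0. Qed.

Lemma dpair_pmf_sum1 : \sum_p mu p.1 * nu p.1 p.2 = 1.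
Proof.
rewrite -(pair_bigA _ (fun t u => mu t * nu t u)) /= -[RHS](pmf_sum1 mu).
by apply: eq_bigr => t _; rewrite -mulr_sumr pmf_sum1 mulr1.
Qed.

Definition dpair_pmf : pmf R (T * U)%type := Pmf dpair_pmf_ge0 dpair_pmf_sum1.

Lemma expect_dpair_pmf (F : T -> U -> R) :
  \E_(p ~ dpair_pmf) F p.1 p.2 = \E_(t ~ mu) \E_(u ~ nu t) F t u.
Proof.
rewrite /expect -(pair_bigA _ (fun t u => mu t * nu t u * F t u)) /=.
apply: eq_bigr => t _; rewrite mulr_sumr.
by apply: eq_bigr => u _; rewrite mulrA.
Qed.

End DependentPair.

(** * Exponential moments of random signs *)

Lemma expR_le_invB (R : realType) (y : R) : y < 1 -> expR y <= (1 - y)^-1.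
Proof.
move=> y_lt1; have := expR_ge1Dx (- y); rewrite expRN => expR_ge.
by rewrite -[expR y]invrK lef_pV2 // posrE ?invr_gt0 ?expR_gt0 // subr_gt0.
Qed.

Lemma cosh_le_expR (R : realType) (x : R) :
  (expR x + expR (- x)) / 2 <= expR (2 * x ^+ 2).
Proof.
have [small|large] := lerP (x ^+ 2) (1 / 2); last first.
  have le_y (y : R) : y ^+ 2 = x ^+ 2 -> expR y <= expR (2 * x ^+ 2).
    by move=> yx; rewrite ler_expR; nra.
  have := le_y x erefl; have := le_y (- x) (sqrrN _); lra.
have /andP[x_gtN1 x_lt1] : -1 < x < 1 by apply/andP; split; nra.
have le_pos := expR_le_invB x_lt1.
have le_neg : expR (- x) <= (1 - - x)^-1 by apply: expR_le_invB; lra.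
apply: le_trans (expR_ge1Dx _).
apply: (@le_trans _ _ (((1 - x)^-1 + (1 - - x)^-1) / 2)).
  by rewrite ler_pM2r ?invr_gt0 //; exact: lerD.
have -> : ((1 - x)^-1 + (1 - - x)^-1) / 2 = (1 - x ^+ 2)^-1.
  by field; apply/and3P; split; apply: lt0r_neq0; nra.
by rewrite -[leLHS]mul1r ler_pdivrMr; nra.
Qed.

Lemma expR_expect_le (R : realType) (T : finType) (mu : pmf R T) (f : T -> R) :
  expR (expect mu f) <= \E_(t ~ mu) expR (f t).
Proof.
set m := expect mu f.
have <- : \E_(t ~ mu) (expR m * (1 + (f t - m))) = expR m.
  by rewrite expectZl expectD expectB !expect_cst -/m subrr addr0 mulr1.
apply: le_expect => t _.
rewrite -[in leRHS](subrK m (f t)) [f t - m + m]addrC expRD.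
by rewrite ler_pM2l ?expR_gt0 // expR_ge1Dx.
Qed.

Lemma mean_expR_sqr_sign_le (R : realType) (c y : R) :
  (expR (c * (1 + y) ^+ 2) + expR (c * (-1 + y) ^+ 2)) / 2 <=
  expR c * expR ((c + 8 * c ^+ 2) * y ^+ 2).
Proof.
have -> : c * (1 + y) ^+ 2 = c + c * y ^+ 2 + 2 * c * y by ring.
have -> : c * (-1 + y) ^+ 2 = c + c * y ^+ 2 + - (2 * c * y) by ring.
have -> : (c + 8 * c ^+ 2) * y ^+ 2 = c * y ^+ 2 + 2 * (2 * c * y) ^+ 2 by ring.
rewrite !expRD mulrA -mulrDr -[leLHS]mulrA ler_pM2l ?mulr_gt0 ?expR_gt0 //.
exact: cosh_le_expR.
Qed.

Section RandomSigns.
Variables (R : realType) (T : finType).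
Implicit Types (s : {ffun T -> bool}) (l : seq T).

Lemma signs_gt0 : (0 < #|{ffun T -> bool}|)%N.
Proof. by rewrite card_ffun card_bool expn_gt0. Qed.

Definition signs : pmf R {ffun T -> bool} := uniform R signs_gt0.

Definition sign_monomial s l : R := \prod_(b <- l) (-1) ^+ s b.

Lemma expect_sign_monomial_ge0 l : 0 <= \E_(s ~ signs) sign_monomial s l.
Proof.
have bool_gt0 : (0 < #|{: bool}|)%N by rewrite card_bool.
rewrite /signs (expect_uniform_ffun bool_gt0) /sign_monomial.
rewrite (expect_prod_pmf_keyed _ id (fun _ (t : bool) => (-1) ^+ t)).
apply: prodr_ge0 => b _; rewrite expect_uniform divr_ge0 //.
rewrite big_bool /= expr1 expr0 big1_eq big_const_seq iter_mulr_1.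
by rewrite -signr_odd; case: (odd _); rewrite ?expr1 ?addNr ?expr0 ?addr_ge0.
Qed.

Definition flip_sign (b : T) s : {ffun T -> bool} :=
  [ffun c => (c == b) (+) s c].

Lemma flip_signK b : involutive (flip_sign b).
Proof. by move=> s; apply/ffunP => c; rewrite !ffunE addKb. Qed.

Lemma expect_signs_flip b (f : {ffun T -> bool} -> R) :
  expect signs f = \E_(s ~ signs) ((f s + f (flip_sign b s)) / 2).
Proof.
under [RHS]eq_expect do rewrite mulrC.
rewrite expectZl expectD (expect_uniform_inj _ _ (inv_inj (flip_signK b))).
by field.
Qed.

(* Averaging over one sign turns [c] into at most [c + 8 c ^ 2], which therefore
   stays below [C] along the induction. *)
Lemma expect_expR_sqr_sum_sign_seq l (c C : R) :
  uniq l -> 0 <= c -> c + 8 * C ^+ 2 * (size l)%:R <= C ->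
  \E_(s ~ signs) expR (c * (\sum_(b <- l) (-1) ^+ s b) ^+ 2) <=
  expR (C * (size l)%:R).
Proof.
elim: l c => [|b0 l IH] c /=.
  move=> _ _ _; under eq_expect do rewrite big_nil expr0n mulr0 expR0.
  by rewrite expect_cst mulr0 expR0.
move=> /andP[b0_notin l_uniq] c_ge0; rewrite -(natr1 (size l)) => c_le.
have C2_ge0 := sqr_ge0 C.
have n_ge0 : 0 <= (size l)%:R :> R by [].
have c_le_C : c <= C by nra.
pose Y s : R := \sum_(b <- l) (-1) ^+ s b.
have Y_flip s : Y (flip_sign b0 s) = Y s.
  apply: eq_big_seq => b bl; rewrite ffunE.
  by case: eqP => [bb|//]; rewrite -bb bl in b0_notin.
rewrite (expect_signs_flip b0).
apply: (@le_trans _ _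
  (expR c * \E_(s ~ signs) expR ((c + 8 * c ^+ 2) * Y s ^+ 2))).
  rewrite -expectZl; apply: le_expect => s _.
  rewrite !big_cons -!/(Y _) Y_flip ffunE eqxx addTb signrN.
  apply: le_trans (mean_expR_sqr_sign_le _ _).
  by case: (s b0); rewrite ?expr1 ?expr0 ?opprK // addrC.
rewrite [in leRHS]mulrDr mulr1 [in leRHS]addrC expRD.
apply: (@le_trans _ _ (expR c * expR (C * (size l)%:R))); last first.
  by rewrite ler_pM2r ?expR_gt0 // ler_expR.
rewrite ler_pM2l ?expR_gt0 //.
have c2_le : c ^+ 2 <= C ^+ 2.
  by rewrite ler_pXn2r // nnegrE // (le_trans c_ge0).
apply: IH => //; first by rewrite addr_ge0 // mulr_ge0 // sqr_ge0.
lra.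
Qed.

Lemma expect_expR_sqr_sum_sign (A : {set T}) (c : R) :
  0 <= c -> 32 * (c * #|A|%:R) <= 1 ->
  \E_(s ~ signs) expR (c * (\sum_(b in A) (-1) ^+ s b) ^+ 2) <=
  expR (2 * (c * #|A|%:R)).
Proof.
move=> c_ge0 cA_le.
have := @expect_expR_sqr_sum_sign_seq (enum A) c (2 * c) (enum_uniq _) c_ge0.
rewrite -cardE -(mulrA 2 c) => le_seq; apply: le_trans (le_seq _); last by nra.
by apply: le_expect => s _; rewrite big_enum.
Qed.

Section SignFamilies.
Variable Z : finType.

(* Jensen's inequality with weights proportional to [#|L z|] reduces the product
   to the exponential moments of the separate sums. *)
Lemma expect_prod_sqr_sum_sign (L : Z -> {set T}) (c : R) :
  0 <= c -> 32 * (c * \sum_z #|L z|%:R) <= 1 ->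
  \E_(s ~ signs) \prod_z (1 + c * (\sum_(b in L z) (-1) ^+ s b) ^+ 2) <=
  expR (2 * (c * \sum_z #|L z|%:R)).
Proof.
move=> c_ge0; set tot : R := \sum_z _ => ctot_le.
pose Y s z : R := \sum_(b in L z) (-1) ^+ s b.
have tot_ge0 : 0 <= tot by apply: sumr_ge0.
have [tot_eq0|tot_neq0] := eqVneq tot 0.
  have Lz z : L z = set0.
    apply/eqP; rewrite -cards_eq0 -(pnatr_eq0 R).
    move/eqP: tot_eq0; rewrite psumr_eq0 // => /allP tot_eq0.
    exact: tot_eq0 (mem_index_enum z).
  rewrite tot_eq0 !mulr0 expR0 -[leRHS](expect_cst signs).
  apply: le_expect => s _.
  by rewrite big1 // => z _; rewrite Lz big_set0 expr0n mulr0 addr0.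
pose p z : R := #|L z|%:R / tot.
have p_ge0 z : 0 <= p z by rewrite divr_ge0.
have p_sum1 : \sum_z p z = 1 by rewrite -mulr_suml divff.
pose weights := Pmf p_ge0 p_sum1.
pose cw z : R := c * tot / #|L z|%:R.
apply: (@le_trans _ _
  (\E_(s ~ signs) \E_(z ~ weights) expR (cw z * Y s z ^+ 2))).
  apply: le_expect => s _; apply: le_trans (expR_expect_le _ _).
  rewrite expR_sum; apply: ler_prod => z _.
  rewrite addr_ge0 ?(mulr_ge0 c_ge0) ?sqr_ge0 //=.
  have -> : c * Y s z ^+ 2 = p z * (cw z * Y s z ^+ 2).
    rewrite /p /cw; have [Lz|Lz] := eqVneq (L z) set0.
      by rewrite /Y Lz big_set0 expr0n !mulr0.
    by field; rewrite tot_neq0 pnatr_eq0 cards_eq0 Lz.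
  exact: expR_ge1Dx.
rewrite exchange_expect -[leRHS](expect_cst weights).
apply: le_expect => z.
rewrite /= /p mulf_eq0 negb_or pnatr_eq0 => /andP[Lz _].
have cwL : cw z * #|L z|%:R = c * tot by rewrite /cw mulfVK // pnatr_eq0.
have cw_ge0 : 0 <= cw z by rewrite !mulr_ge0 ?invr_ge0.
by have := @expect_expR_sqr_sum_sign (L z) _ cw_ge0; rewrite cwL; exact.
Qed.

Variable l : Z -> seq T.

Lemma expect_prod_sign_monomial (a : Z -> R) :
  \E_(s ~ signs) \prod_z (1 + a z * sign_monomial s (l z)) =
  \sum_(J : {set Z}) (\prod_(z in J) a z) *
    \E_(s ~ signs) sign_monomial s (flatten [seq l z | z <- enum J]).
Proof.
transitivity (\E_(s ~ signs) \sum_(J : {set Z})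
    (\prod_(z in J) a z) * sign_monomial s (flatten [seq l z | z <- enum J])).
  apply: eq_expect => s; under eq_bigr do rewrite addrC.
  rewrite bigA_distr; apply: eq_bigr => J _.
  rewrite /sign_monomial big_flatten big_map big_enum /= -big_split.
  by rewrite [RHS]big_mkcond.
by rewrite expect_sum; apply: eq_bigr => J _; rewrite expectZl.
Qed.

(* The mean of a monomial in independent signs is nonnegative, so the expanded
   products are dominated termwise once coefficients are replaced by bounds on
   their absolute values. *)
Lemma expect_prod_sign_monomial_diff_le (k1 k2 a : Z -> R) :
  (forall z, `|k1 z| <= a z) -> (forall z, `|k2 z| <= a z) ->
  `|\E_(s ~ signs) \prod_z (1 + k1 z * sign_monomial s (l z)) -
    \E_(s ~ signs) \prod_z (1 + k2 z * sign_monomial s (l z))| <=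
  2 * (\E_(s ~ signs) \prod_z (1 + a z * sign_monomial s (l z)) - 1).
Proof.
move=> k1_le k2_le.
have prod_le k (J : {set Z}) : (forall z, `|k z| <= a z) ->
    `|\prod_(z in J) k z| <= \prod_(z in J) a z.
  move=> k_le; rewrite normr_prod; apply: ler_prod => z _.
  by rewrite normr_ge0 k_le.
rewrite !expect_prod_sign_monomial -sumrB.
rewrite (bigD1 set0) //= !big_set0 subrr add0r.
rewrite [in leRHS](bigD1 set0) //= big_set0 mul1r enum_set0 /=.
rewrite [X in _ <= _ * (X + _ - _)](_ : _ = 1); last first.
  by under eq_expect do rewrite /sign_monomial big_nil; exact: expect_cst.
rewrite [1 + _]addrC addrK mulr_sumr.
apply: le_trans (ler_norm_sum _ _ _) _; apply: ler_sum => J _.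
rewrite -mulrBl normrM (ger0_norm (expect_sign_monomial_ge0 _)) mulrA.
apply: ler_wpM2r; first exact: expect_sign_monomial_ge0.
by apply: le_trans (ler_normB _ _) _; rewrite mulr_natl mulr2n lerD ?prod_le.
Qed.

End SignFamilies.
End RandomSigns.

(** * Distance on the cube *)

Lemma flip_involutive n (i : 'I_n) : involutive (flip i).
Proof.
by move=> x; apply/ffunP => j; rewrite !ffunE; case: eqP; rewrite ?negbK.
Qed.

Lemma flip_inj n (i : 'I_n) : injective (flip i).
Proof. exact/inv_inj/flip_involutive. Qed.

Lemma flip_eq n (i : 'I_n) (x : cube n) : flip i x i = ~~ x i.
Proof. by rewrite ffunE eqxx. Qed.

Lemma flip_neq n (i j : 'I_n) (x : cube n) : j != i -> flip i x j = x j.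
Proof. by move=> ji; rewrite ffunE (negPf ji). Qed.

Lemma independent_flip n (f : boolfun n) (i : 'I_n) x :
  ~~ depends_on f i -> f (flip i x) = f x.
Proof. by move=> /existsPn/(_ x); rewrite negbK => /eqP. Qed.

Lemma card_cube n : #|cube n| = (2 ^ n)%N.
Proof. by rewrite card_ffun card_bool card_ord. Qed.

Lemma cube_gt0 n : (0 < #|cube n|)%N.
Proof. by rewrite card_cube expn_gt0. Qed.

Section CubeDistance.
Variables (R : realType) (n : nat).
Implicit Types (f g : boolfun n) (P : {set boolfun n}).

Definition cube_law : pmf R (cube n) := uniform R (cube_gt0 n).

Lemma distE f g : dist R f g = \P_(x ~ cube_law) (f x != g x).
Proof.
rewrite prob_uniform /dist; congr (_%:R / _).
by apply: eq_card => x; rewrite inE.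
Qed.

Lemma dist_class_le f g P : g \in P -> dist_class R f P <= dist R f g.
Proof. by move=> gP; exact: bigmin_le_cond. Qed.

Lemma lt_dist_class f P e :
  e < 1 -> (forall g, g \in P -> e < dist R f g) -> e < dist_class R f P.
Proof. by move=> e_lt1 e_lt; apply: lt_bigmin => // g; exact: e_lt. Qed.

Lemma prob_le_2dist f g (H : pred (cube n)) (phi : cube n -> cube n) :
  injective phi -> (forall x, H x -> f (phi x) = ~~ f x) ->
  (forall x, H x -> g (phi x) = g x) -> prob cube_law H <= 2 * dist R f g.
Proof.
move=> phi_inj f_phi g_phi; rewrite distE !probE mulr_natl mulr2n.
rewrite -[X in X + _](expect_uniform_inj _ _ phi_inj) -expectD.
apply: le_expect => x _; case: (boolP (H x)) => [Hx|_]; last exact: addr_ge0.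
by rewrite f_phi // g_phi //; case: (f x); case: (g x);
  rewrite /= ?addr0 ?add0r.
Qed.

Lemma expect_sign_mul f g :
  \E_(x ~ cube_law) ((-1) ^+ f x * (-1) ^+ g x) = 1 - 2 * dist R f g.
Proof.
rewrite distE probE -expectZl -[X in _ = X - _](expect_cst cube_law) -expectB.
apply: eq_expect => x.
by case: (f x); case: (g x); rewrite /= ?expr1 ?expr0; ring.
Qed.

Definition flip_corr f (c c' : 'I_n) : R :=
  \E_(x ~ cube_law) ((-1) ^+ f (flip c x) * (-1) ^+ f (flip c' x)).

(* Averaging the correlation of [f] with [g] over the coordinates that [g]
   ignores, and applying Cauchy-Schwarz, only the correlations between flips of
   [f] remain. *)
Lemma sqr_sign_corr_le f g (D : {set 'I_n}) (delta : R) :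
  (0 < #|D|)%N -> {in D, forall c, ~~ depends_on g c} ->
  {in D &, forall c c', flip_corr f c c' <= (c == c')%:R + delta} ->
  (1 - 2 * dist R f g) ^+ 2 <= #|D|%:R^-1 + delta.
Proof.
move=> D_gt0 g_ignores corr; rewrite -expect_sign_mul; set S := expect _ _.
have natr_D_gt0 : 0 < #|D|%:R :> R by rewrite ltr0n.
pose sum_flips x : R := \sum_(c in D) (-1) ^+ f (flip c x).
have DS : #|D|%:R * S = \E_(x ~ cube_law) ((-1) ^+ g x * sum_flips x).
  transitivity (\sum_(c in D) S); first by rewrite sumr_const mulr_natl.
  rewrite (eq_bigr (fun c =>
    \E_(x ~ cube_law) ((-1) ^+ g x * (-1) ^+ f (flip c x)))).
    by rewrite -expect_sum; apply: eq_expect => x; rewrite mulr_sumr.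
  move=> c cD; rewrite /S -(expect_uniform_inj _ _ (@flip_inj n c)).
  by apply: eq_expect => x; rewrite (independent_flip _ (g_ignores _ cD)) mulrC.
have sqr_sum : \E_(x ~ cube_law) sum_flips x ^+ 2 <=
    #|D|%:R + #|D|%:R ^+ 2 * delta.
  have -> : \E_(x ~ cube_law) sum_flips x ^+ 2 =
      \sum_(c in D) \sum_(c' in D) flip_corr f c c'.
    transitivity (\E_(x ~ cube_law) \sum_(c in D) \sum_(c' in D)
        (-1) ^+ f (flip c x) * (-1) ^+ f (flip c' x)).
      apply: eq_expect => x; rewrite expr2 mulr_suml.
      by apply: eq_bigr => c _; rewrite mulr_sumr.
    by rewrite expect_sum; apply: eq_bigr => c _; rewrite expect_sum.
  apply: (@le_trans _ _ (\sum_(c in D) (1 + #|D|%:R * delta))); last first.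
    by rewrite sumr_const -[leLHS]mulr_natl mulrDr mulr1 mulrA.
  apply: ler_sum => c cD.
  apply: (@le_trans _ _ (\sum_(c' in D) ((c == c')%:R + delta))).
    by apply: ler_sum => c' c'D; exact: corr.
  rewrite big_split sumr_const mulr_natl lerD2r /=.
  rewrite (bigD1 c) //= eqxx big1 ?addr0 // => c' /andP[_ /negPf].
  by rewrite eq_sym => ->.
rewrite -(ler_pM2l (exprn_gt0 2 natr_D_gt0)) -exprMn DS mulrDr.
rewrite [in X in X + _]expr2 mulfK ?gt_eqF //.
apply: le_trans sqr_sum; apply: le_trans (sqr_expect_le _ _) _.
by apply: le_expect => x _; rewrite exprMn sqrr_sign mul1r.
Qed.

End CubeDistance.

Definition parity n : boolfun n :=
  [ffun x : cube n => \big[addb/false]_(i < n) x i].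

Lemma parity_flip n i (x : cube n) : parity n (flip i x) = ~~ parity n x.
Proof.
rewrite !ffunE (bigD1 i) //= flip_eq addNb; congr (~~ _).
rewrite [RHS](bigD1 i) //=; congr (_ (+) _).
by apply: eq_bigr => j ji; rewrite flip_neq.
Qed.

Lemma parity_far (R : realType) n k (e : R) :
  (k < n)%N -> e < 1 / 2 -> e < dist_class R (parity n) (juntas n k).
Proof.
move=> k_lt_n e_lt; apply: lt_dist_class => [|g]; first by lra.
rewrite inE; set J := [set i | depends_on g i] => J_le.
have [i i_notin] : exists i, i \notin J.
  apply/existsP; apply: contraTT k_lt_n => /existsPn allJ; rewrite -leqNgt.
  apply: leq_trans J_le; rewrite -[X in (X <= _)%N]card_ord -cardsT.
  apply: subset_leq_card; apply/subsetP => i _.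
  by have := allJ i; rewrite negbK.
have := @prob_le_2dist R n (parity n) g predT (flip i) (@flip_inj n i)
  (fun x _ => parity_flip i x) (fun x _ => independent_flip x _).
rewrite probE expect_cst; move: i_notin; rewrite inE => i_free /(_ i_free).
lra.
Qed.

Lemma cst_junta n k b : [ffun=> b] \in juntas n k.
Proof.
rewrite inE (_ : [set i | _] = set0) ?cards0 //; apply/setP => i.
by rewrite !inE; apply/existsP => -[x]; rewrite !ffunE eqxx.
Qed.

Lemma dist_class_mem (R : realType) n (f : boolfun n) (P : {set boolfun n}) :
  f \in P -> dist_class R f P <= 0.
Proof.
move=> /(dist_class_le R f); rewrite distE probE (@eq_expect _ _ _ _ (fun=> 0)).
  by rewrite expect_cst.
by move=> x; rewrite eqxx.
Qed.

(** * Nonadaptive testers against random functions *)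

Section Testers.
Variables (R : realType) (n q : nat) (T : nonadaptive_tester R n q).

Definition seed_law : pmf R (seed T) :=
  Pmf (@seed_pr_ge0 _ _ _ T) (seed_pr_sum1 T).

Lemma accept_prE f : accept_pr T f = \E_(sd ~ seed_law) (accepts f sd)%:R.
Proof. exact: (probE seed_law). Qed.

Lemma reject_prE f : reject_pr T f = 1 - accept_pr T f.
Proof. exact: (probC seed_law). Qed.

Variables (eps0 eps1 : R) (P : {set boolfun n}).
Hypothesis T_tolerant : is_tolerant_tester eps0 eps1 P T.

Lemma tolerant_accept f : dist_class R f P <= eps0 -> 2 / 3 <= accept_pr T f.
Proof. by have [] := T_tolerant f. Qed.

Lemma tolerant_reject f : eps1 < dist_class R f P -> accept_pr T f <= 1 / 3.
Proof. by have [_ rej] := T_tolerant f; move/rej; rewrite reject_prE; lra. Qed.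

Lemma tolerant_tester_queries_gt0 (f g : boolfun n) :
  dist_class R f P <= eps0 -> eps1 < dist_class R g P -> (0 < q)%N.
Proof.
move=> /tolerant_accept acc_f /tolerant_reject acc_g.
rewrite lt0n; apply/eqP => q_eq0.
have acc_eq : accept_pr T f = accept_pr T g.
  apply: eq_bigl => sd; rewrite /accepts; congr (verdict _ _).
  by apply: eq_from_tnth => i; have := ltn_ord i; rewrite [X in (_ < X)%N]q_eq0.
lra.
Qed.

Lemma tolerant_tester_advantage (Om : finType) (yes no : pmf R Om)
    (F : Om -> boolfun n) (p delta : R) :
  (forall o, yes o != 0 -> dist_class R (F o) P <= eps0) ->
  \P_(o ~ no) ~~ (eps1 < dist_class R (F o) P) <= p ->
  (forall (Q : q.-tuple (cube n)) (V : q.-tuple bool -> bool),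
     \P_(o ~ yes) V (map_tuple (F o) Q) -
     \P_(o ~ no) V (map_tuple (F o) Q) <= delta) ->
  1 / 3 <= p + delta.
Proof.
move=> close far indist.
have accept_yes : 2 / 3 <= \E_(o ~ yes) accept_pr T (F o).
  rewrite -[leLHS](expect_cst yes); apply: le_expect => o /close.
  exact: tolerant_accept.
have accept_no : \E_(o ~ no) accept_pr T (F o) <= 1 / 3 + p.
  apply: le_trans (lerD (lexx (1 / 3)) far).
  rewrite probE -[X in X + _](expect_cst no) -expectD; apply: le_expect => o _.
  have [/tolerant_reject|_] := boolP (eps1 < _); first by rewrite addr0.
  apply: le_trans (prob_le1 seed_law _) _; rewrite /=; lra.
have gap : \E_(o ~ yes) accept_pr T (F o) -
    \E_(o ~ no) accept_pr T (F o) <= delta.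
  have seedwise (mu : pmf R Om) : \E_(o ~ mu) accept_pr T (F o) =
      \E_(sd ~ seed_law) \P_(o ~ mu) accepts (F o) sd.
    under eq_expect do rewrite accept_prE.
    by rewrite exchange_expect; apply: eq_expect => sd; rewrite probE.
  rewrite !seedwise -expectB -[leRHS](expect_cst seed_law).
  by apply: le_expect => sd _; exact: indist.
lra.
Qed.

End Testers.

(** * The hard functions *)

Lemma sum_odd_eq0 (R : realFieldType) (T : finType) (h : T -> T) (P : pred T)
    (F : T -> R) :
  injective h -> (forall t, P (h t) = P t) -> (forall t, F (h t) = - F t) ->
  \sum_(t | P t) F t = 0.
Proof.
move=> h_inj P_h F_h; set S := \sum_(t | _) _.
have : S = - S.
  rewrite {1}/S (reindex_inj h_inj) -sumrN.
  by apply: eq_big => t; rewrite ?P_h ?F_h.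
lra.
Qed.

Lemma card_bigcup_le (I T : finType) (P : pred I) (F : I -> {set T}) :
  (#|\bigcup_(i | P i) F i| <= \sum_(i | P i) #|F i|)%N.
Proof.
elim/big_rec2: _ => [|i c A _ le_c]; first by rewrite cards0.
by apply: leq_trans (leq_card_setU _ _) _; rewrite leq_add2l.
Qed.

Section HardFunctions.
Variables (n : nat) (Block Pair : finType)
  (coord : Block * Pair * bool -> 'I_n).
Hypothesis coord_inj : injective coord.
Implicit Types (w : {ffun Block -> Pair}) (s : {ffun Block -> bool})
  (u : Block * bool).

Definition gate : finType := ((Block * bool) * (Block * bool) * bool)%type.
Definition circuit : finType := {ffun cube n -> gate}.
Implicit Types (d : gate) (G : circuit) (uu : (Block * bool) * (Block * bool)).

(* [w] selects the active pair of each block. Coordinates outside the range of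
   [coord] are irrelevant, and [control_part] masks them out together with the
   active ones. *)
Definition active w u : 'I_n := coord (u.1, w u.1, u.2).

Definition control w : {set 'I_n} := coord @: [set p | p.1.2 != w p.1.1].

Definition control_part w (x : cube n) : cube n :=
  [ffun i => (i \in control w) && x i].

Definition gate_value w d (x : cube n) : bool :=
  d.2 (+) (x (active w d.1.1) (+) x (active w d.1.2)).

Definition hard_fun w G : boolfun n :=
  [ffun x => gate_value w (G (control_part w x)) x].

Definition side s u : bool := u.2 (+) s u.1.

Definition opposite s uu : bool := side s uu.1 (+) side s uu.2.

Lemma active_inj w : injective (active w).
Proof. by move=> [b t] [b' t'] /coord_inj [-> _ ->]. Qed.

Lemma active_notin_control w u : active w u \notin control w.
Proof.
apply/imsetP => -[[[b c] t]]; rewrite inE /= => cw /coord_inj [eb ec _].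
by rewrite -eb ec eqxx in cw.
Qed.

Lemma control_part_flip w i x :
  i \notin control w -> control_part w (flip i x) = control_part w x.
Proof.
move=> iw; apply/ffunP => j; rewrite !ffunE.
by case: eqP => [->|//]; rewrite (negPf iw).
Qed.

Lemma coord_active_or_control w b c t :
  coord (b, c, t) \in control w \/ coord (b, c, t) = active w (b, t).
Proof.
have [->|cw] := eqVneq c (w b); [by right|left].
by apply: imset_f; rewrite inE.
Qed.

Lemma card_control w : (#|control w| + 2 * #|Block| = 2 * #|Pair| * #|Block|)%N.
Proof.
rewrite card_imset //.
have -> : (2 * #|Block| =
    #|[set p : Block * Pair * bool | p.1.2 == w p.1.1]|)%N.
  have -> : [set p : Block * Pair * bool | p.1.2 == w p.1.1] =
      [set (u.1, w u.1, u.2) | u : Block * bool].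
    apply/setP => -[[b c] t]; rewrite inE /=.
    by apply/eqP/imsetP => [->|[u _ [-> -> _]] //]; exists (b, t).
  rewrite card_imset; last by move=> [b t] [b' t'] [-> _ ->].
  by rewrite card_prod card_bool mulnC.
rewrite addnC; have -> : [set p : Block * Pair * bool | p.1.2 != w p.1.1] =
    ~: [set p | p.1.2 == w p.1.1] by apply/setP => p; rewrite !inE.
by rewrite cardsC !card_prod card_bool; lia.
Qed.

Lemma card_side s e : #|[set u | side s u == e]| = #|Block|.
Proof.
have -> : [set u | side s u == e] = [set (b, e (+) s b) | b : Block].
  apply/setP => -[b t]; rewrite inE /side /=.
  apply/eqP/imsetP => [<-|[b' _ [-> ->]]]; last by rewrite addbK.
  by exists b => //; rewrite addbK.
by rewrite card_imset // => b b' [].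
Qed.

Lemma card_control_part_fiber w z :
  (#|[pred x | control_part w x == z]| * 2 ^ #|control w| <= #|cube n|)%N.
Proof.
pose F i : {set bool} := if i \in control w then [set z i] else setT.
have sub : [pred x | control_part w x == z] \subset setXn F.
  apply/subsetP => x; rewrite inE => /eqP zE; apply/setXnP => i.
  by rewrite /F -zE ffunE; case: (i \in control w) => //; rewrite !inE.
apply: leq_trans (leq_mul (subset_leq_card sub) (leqnn _)) _.
rewrite cardsXn -prod_nat_const [X in (_ * X)%N]big_mkcond -big_split /=.
rewrite (eq_bigr (fun=> 2%N)) ?prod_nat_const ?card_ord ?card_cube // => i _.
by rewrite /F; case: (i \in control w); rewrite ?cards1 // cardsT card_bool.
Qed.

Section Laws.
Variable R : realType.

Lemma prob_control_part_le w z :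
  \P_(x ~ cube_law R n) (control_part w x == z) <= (2 ^+ #|control w|)^-1.
Proof.
rewrite prob_uniform ler_pdivrMr ?natr_card_gt0 ?cube_gt0 // mulrC.
rewrite ler_pdivlMr ?exprn_gt0 // -natrX -natrM ler_nat.
exact: card_control_part_fiber.
Qed.

(** * Distance of the hard functions to juntas *)

Definition pinned_fun w s G (e c : bool) : boolfun n :=
  [ffun x => let d := G (control_part w x) in
     if side s d.1.1 == e then d.2 (+) c else gate_value w d x].

Lemma pinned_fun_junta w s G e c k :
  (forall z, ~~ opposite s (G z).1) ->
  (2 * #|Pair| * #|Block| <= k + #|Block|)%N ->
  pinned_fun w s G e c \in juntas n k.
Proof.
move=> same k_ge; rewrite inE; set D := [set i | _].
have sub : D \subset control w :|: active w @: [set u | side s u == ~~ e].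
  apply/subsetP => i; rewrite inE; apply: contraLR; rewrite in_setU negb_or.
  move=> /andP[iw i_active]; apply/existsPn => x.
  rewrite negbK !ffunE control_part_flip //=; set d := G _.
  case: ifP => // /negbT side1.
  have side2 : side s d.1.2 != e.
    move: (same (control_part w x)) side1.
    by rewrite /opposite -/d; case: (e); do 2 case: side.
  have unread u : side s u != e -> flip i x (active w u) = x (active w u).
    move=> su; apply: flip_neq; apply: contraNneq i_active => <-.
    by apply: imset_f; rewrite inE; move: su; case: (e); case: side.
  by rewrite /gate_value !unread.
apply: leq_trans (subset_leq_card sub) _.
apply: leq_trans (leq_card_setU _ _) _.
rewrite card_imset ?card_side; last exact: active_inj.
by rewrite -(leq_add2r #|Block|) -addnA addnn -mul2n card_control.
Qed.

(* Every point is a mismatch of exactly one of the four pinned functions. *)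
Lemma sum_dist_pinned_fun w s G :
  \sum_e \sum_c dist R (hard_fun w G) (pinned_fun w s G e c) = 1.
Proof.
rewrite -[RHS](expect_cst (cube_law R n)) !big_bool /= !distE !probE -!expectD.
apply: eq_expect => x; rewrite !ffunE /gate_value /=.
case: (side s _); case: (G _).2; case: (_ (+) x _);
  by rewrite /= ?mulr0n ?add0r ?addr0.
Qed.

Lemma same_side_close w s G k :
  (forall z, ~~ opposite s (G z).1) ->
  (2 * #|Pair| * #|Block| <= k + #|Block|)%N ->
  dist_class R (hard_fun w G) (juntas n k) <= 1 / 4.
Proof.
move=> same k_ge.
have le_dist e c : dist_class R (hard_fun w G) (juntas n k) <=
    dist R (hard_fun w G) (pinned_fun w s G e c).
  exact: dist_class_le (pinned_fun_junta w e c same k_ge).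
have := sum_dist_pinned_fun w s G; rewrite !big_bool /=.
have := le_dist true true; have := le_dist true false.
have := le_dist false true; have := le_dist false false; lra.
Qed.

Hypothesis Block_gt0 : (0 < #|Block|)%N.
Local Notation h := (#|Block|%:R : R).

Lemma natr_card_Block_gt0 : 0 < h. Proof. by rewrite ltr0n. Qed.

Lemma card_gate : #|gate|%:R = 8 * h ^+ 2 :> R.
Proof. by rewrite !card_prod card_bool !natrM; ring. Qed.

Lemma gate_gt0 : (0 < #|gate|)%N.
Proof. by rewrite !card_prod card_bool !muln_gt0 Block_gt0. Qed.

Definition uniform_gate : pmf R gate := uniform R gate_gt0.

Definition gate_sign s d : R := (-1) ^+ opposite s d.1.

Definition gate_weight (tau : bool) s d : R :=
  uniform_gate d * (1 + (-1) ^+ tau * gate_sign s d).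

Lemma gate_weightE tau s d :
  gate_weight tau s d = if opposite s d.1 == tau then 2 / #|gate|%:R else 0.
Proof.
rewrite /gate_weight /gate_sign mulrC.
by case: tau; case: opposite;
  rewrite /= ?expr1 ?expr0 ?mulr1 ?mulrN1 ?opprK ?subrr ?mul0r.
Qed.

Lemma gate_weight_ge0 tau s d : 0 <= gate_weight tau s d.
Proof. by rewrite gate_weightE; case: ifP => // _; rewrite divr_ge0. Qed.

Lemma sum_gate_weight tau s : \sum_d gate_weight tau s d = 1.
Proof.
pose swap d : gate := ((d.1.1.1, ~~ d.1.1.2), d.1.2, d.2).
have swapK : involutive swap by move=> [[[b t] u] r]; rewrite /swap /= negbK.
rewrite [LHS](expectD uniform_gate (fun=> 1)) expect_cst expectZl.
rewrite [expect _ _](sum_odd_eq0 (inv_inj swapK)) ?mulr0 ?addr0 // => d.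
by rewrite /gate_sign /opposite /side /= !addNb signrN mulrN.
Qed.

(* The uniform law on gates conditioned on the two inputs lying on the same side
   ([tau = false]) or on opposite sides ([tau = true]). *)
Definition gate_law tau s : pmf R gate :=
  Pmf (gate_weight_ge0 tau s) (sum_gate_weight tau s).

Definition circuit_law tau s : pmf R circuit := prod_pmf (fun=> gate_law tau s).

Lemma circuit_law_opposite tau s G :
  circuit_law tau s G != 0 -> forall z, opposite s (G z).1 = tau.
Proof.
move=> /prodf_neq0 Gz z; apply/eqP; move: (Gz z isT).
by rewrite /= gate_weightE; case: ifP => //; rewrite eqxx.
Qed.

Lemma expect_gate_value_sign tau s w x :
  \E_(d ~ gate_law tau s) (-1) ^+ gate_value w d x = 0.
Proof.
pose negate d : gate := (d.1, ~~ d.2).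
have negateK : involutive negate by move=> [? ?]; rewrite /negate /= negbK.
by apply: (sum_odd_eq0 (inv_inj negateK)) => // d;
  rewrite /gate_value /= addNb signrN mulrN.
Qed.

Lemma prob_gate_inputs tau s uu :
  opposite s uu = tau -> \P_(d ~ gate_law tau s) (d.1 == uu) = (2 * h ^+ 2)^-1.
Proof.
move=> uu_tau; rewrite /prob /= (eq_bigr (fun=> 2 / #|gate|%:R)); last first.
  by move=> d /eqP du; rewrite gate_weightE du uu_tau eqxx.
rewrite sumr_const (_ : #|_| = #|setX [set uu] [set: bool]|); last first.
  by apply: eq_card => d; rewrite !inE andbT.
rewrite cardsX cards1 cardsT card_bool card_gate -[LHS]mulr_natl.
by field; rewrite gt_eqF // natr_card_Block_gt0.
Qed.

Definition gate_freq w G uu : R :=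
  \P_(x ~ cube_law R n) ((G (control_part w x)).1 == uu).

Lemma prob_gate_freq_deviates_le tau s w uu (eps : R) :
  0 < eps -> opposite s uu = tau ->
  \P_(G ~ circuit_law tau s) (eps <= `|gate_freq w G uu - (2 * h ^+ 2)^-1|) <=
  (2 ^+ #|control w|)^-1 / eps ^+ 2.
Proof.
move=> eps_gt0 uu_tau; set p := (2 * h ^+ 2)^-1.
have p_itv : 0 <= p <= 1.
  by rewrite /p -(prob_gate_inputs uu_tau) prob_ge0 prob_le1.
pose Z (x : cube n) d : R := (d.1 == uu)%:R - p.
have meanZ x : \E_(d ~ gate_law tau s) Z x d = 0.
  rewrite expectB expect_cst -(probE _ (fun d => d.1 == uu)).
  by rewrite prob_gate_inputs ?subrr.
have freqE G : gate_freq w G uu - p =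
    \E_(x ~ cube_law R n) Z x (G (control_part w x)).
  by rewrite expectB expect_cst /gate_freq probE.
rewrite /prob; under eq_bigl do rewrite freqE; rewrite -/(prob _ _).
apply: (@chebyshev_sparse _ _ _ _ _
  (fun x G => Z x (G (control_part w x)))
  (fun x y => control_part w y == control_part w x)) => //.
- by move=> x G; rewrite ler_norml /Z; case: (_ == _) => /=; lra.
- move=> x y far.
  transitivity (\E_(G ~ circuit_law tau s)
      \prod_(x' <- [:: x; y]) Z x' (G (control_part w x'))).
    by apply: eq_expect => G; rewrite !big_cons big_nil mulr1.
  apply: (@expect_prod_pmf_keyed_eq0 _ _ _ _ _ _ _ _ (control_part w x)).
  rewrite -[RHS](meanZ x); apply: eq_expect => d.
  by rewrite !big_cons big_nil eqxx (negPf far) mulr1.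
- by move=> x; exact: prob_control_part_le.
Qed.

Lemma prob_flip_corr_ge_le tau s w c c' (eps : R) :
  0 < eps -> c \in control w -> c != c' ->
  \P_(G ~ circuit_law tau s) (eps <= `|flip_corr R (hard_fun w G) c c'|) <=
  2 / 2 ^+ #|control w| / eps ^+ 2.
Proof.
move=> eps_gt0 cw cc'; pose cell i x := control_part w (flip i x).
have cellN x : cell c' x != cell c x.
  apply/eqP => /ffunP/(_ c); rewrite !ffunE cw eqxx (negPf cc') /=.
  by case: (x c).
apply: (@chebyshev_sparse _ _ _ _ _
  (fun x G =>
     (-1) ^+ hard_fun w G (flip c x) * (-1) ^+ hard_fun w G (flip c' x))
  (fun x y => (cell c y == cell c x) || (cell c' y == cell c x))) => //.
- by move=> x G; rewrite normrM !normr_sign mulr1.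
- move=> x y; rewrite negb_or => /andP[far far'].
  transitivity (\E_(G ~ circuit_law tau s)
      \prod_(x' <- [:: flip c x; flip c' x; flip c y; flip c' y])
         (-1) ^+ gate_value w (G (control_part w x')) x' : R).
    apply: eq_expect => G.
    by rewrite !big_cons big_nil ![hard_fun _ _ _]ffunE mulr1 !mulrA.
  apply: (@expect_prod_pmf_keyed_eq0 _ _ _ _ _ _
    (fun x' d => (-1) ^+ gate_value w d x') _ (cell c x)).
  rewrite -[RHS](expect_gate_value_sign tau s w (flip c x)).
  apply: eq_expect => d.
  rewrite !big_cons big_nil -!/(cell _ _) eqxx.
  by rewrite (negPf (cellN x)) (negPf far) (negPf far') mulr1.
have cell_le x i :
    \P_(y ~ cube_law R n) (cell i y == cell c x) <= (2 ^+ #|control w|)^-1.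
  rewrite probE (expect_uniform_inj _
    (fun y => (control_part w y == cell c x)%:R) (@flip_inj n i)) -probE.
  exact: prob_control_part_le.
move=> x; apply: le_trans (prob_or_le _ _ _) _.
by rewrite mulr_natl mulr2n lerD.
Qed.

Definition gates_equidistributed w s G (eps : R) : bool :=
  [forall uu, opposite s uu ==>
     (`|gate_freq w G uu - (2 * h ^+ 2)^-1| <= eps)].

Definition flips_decorrelated w G (delta : R) : bool :=
  [forall c in control w, forall c' in control w, (c != c') ==>
     (flip_corr R (hard_fun w G) c c' <= delta)].

Lemma prob_gates_not_equidistributed_le w s (eps : R) : 0 < eps ->
  \P_(G ~ circuit_law true s) ~~ gates_equidistributed w s G eps <=
  4 * h ^+ 2 * ((2 ^+ #|control w|)^-1 / eps ^+ 2).
Proof.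
move=> eps_gt0.
apply: le_trans (prob_union_le (B := fun uu G => opposite s uu &&
  (eps <= `|gate_freq w G uu - (2 * h ^+ 2)^-1|)) _ _) _.
  move=> G /forallPn[uu]; rewrite negb_imply -ltNge => /andP[suu /ltW dev].
  by exists uu; rewrite suu.
apply: (@le_trans _ _ (\sum_(uu : (Block * bool) * (Block * bool))
    ((2 ^+ #|control w|)^-1 / eps ^+ 2))); last first.
  by rewrite sumr_const !card_prod card_bool -[leLHS]mulr_natl !natrM; lra.
apply: ler_sum => uu _; have [suu|_] := boolP (opposite s uu); last first.
  by rewrite /prob big_pred0 // divr_ge0 ?invr_ge0 ?exprn_ge0 ?ltW.
exact: prob_gate_freq_deviates_le.
Qed.

Lemma prob_flips_correlated_le tau w s (delta : R) : 0 < delta ->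
  \P_(G ~ circuit_law tau s) ~~ flips_decorrelated w G delta <=
  #|control w|%:R ^+ 2 * (2 / 2 ^+ #|control w| / delta ^+ 2).
Proof.
move=> delta_gt0.
apply: le_trans (prob_union_le (B := fun cc G =>
  [&& cc.1 \in control w, cc.2 \in control w, cc.1 != cc.2 &
    delta <= `|flip_corr R (hard_fun w G) cc.1 cc.2|]) _ _) _.
  move=> G /forallPn[c]; rewrite negb_imply => /andP[cw /forallPn[c']].
  rewrite !negb_imply -ltNge => /and3P[c'w cc' /ltW corr]; exists (c, c').
  by rewrite /= cw c'w cc' (le_trans corr) ?ler_norm.
apply: (@le_trans _ _ (\sum_(cc in setX (control w) (control w))
    (2 / 2 ^+ #|control w| / delta ^+ 2))); last first.
  by rewrite sumr_const -[leLHS]mulr_natl cardsX natrM expr2.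
rewrite [leRHS]big_mkcond /=; apply: ler_sum => -[c c'] _; rewrite inE /=.
have [cw|_] := boolP (c \in control w); last by rewrite /prob big_pred0.
have [c'w|_] := boolP (c' \in control w); last by rewrite /prob big_pred0.
have [_|cc'] := eqVneq c c'; last exact: prob_flip_corr_ge_le.
by rewrite /prob big_pred0 // !divr_ge0 ?exprn_ge0 ?ltW.
Qed.

Lemma card_opposite_in s (S : {set Block * bool}) :
  #|[set uu | [&& uu.1 \in S, uu.2 \in S & opposite s uu]]| =
  (2 * (#|[set u in S | ~~ side s u]| * #|[set u in S | side s u]|))%N.
Proof.
set S0 := [set u in S | _]; set S1 := [set u in S | _].
have -> : [set uu | [&& uu.1 \in S, uu.2 \in S & opposite s uu]] =
    setX S0 S1 :|: setX S1 S0.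
  apply/setP => -[u v]; rewrite !inE /opposite /=.
  by case: (u \in S); case: (v \in S); case: (side s u); case: (side s v).
rewrite cardsU !cardsX.
have -> : setX S0 S1 :&: setX S1 S0 = set0.
  apply/setP => -[u v]; rewrite !inE /=.
  by case: (u \in S); case: (v \in S); case: (side s u); case: (side s v).
by rewrite cards0 subn0 [(#|S1| * _)%N]mulnC addnn mul2n.
Qed.

Definition opposite_touching s (S : {set Block * bool}) :
    {set (Block * bool) * (Block * bool)} :=
  [set uu | opposite s uu && ((uu.1 \in S) || (uu.2 \in S))].

Lemma card_opposite_touching s (S : {set Block * bool}) :
  (4 * #|Block| ^ 2 <= 2 * #|opposite_touching s S| + #|~: S| ^ 2)%N.
Proof.
have side_card e : #|[set u in [set: Block * bool] | side s u == e]| = #|Block|.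
  by rewrite -(card_side s e); apply: eq_card => u; rewrite !inE.
have := card_opposite_in s setT.
rewrite (_ : [set u in setT | ~~ side s u] =
    [set u in setT | side s u == false]);
  last by apply/setP => u; rewrite !inE; case: side.
rewrite (_ : [set u in setT | side s u] =
    [set u in setT | side s u == true]);
  last by apply/setP => u; rewrite !inE; case: side.
rewrite !side_card => card_all.
have : (#|[set uu | [&& uu.1 \in setT, uu.2 \in setT & opposite s uu]]| <=
    #|opposite_touching s S| +
    #|[set uu | [&& uu.1 \in ~: S, uu.2 \in ~: S & opposite s uu]]|)%N.
  apply: leq_trans (leq_card_setU _ _); apply: subset_leq_card.
  apply/subsetP => uu; rewrite !inE /= => ->.
  by case: (uu.1 \in S); case: (uu.2 \in S).
rewrite card_all card_opposite_in.
have : (#|[set u in ~: S | ~~ side s u]| + #|[set u in ~: S | side s u]| =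
    #|~: S|)%N.
  rewrite addnC -(cardsID [set u | side s u] (~: S)); congr (_ + _)%N;
    by apply: eq_card => u; rewrite !inE // andbC.
move: #|[set u in _ | ~~ _]| #|[set u in _ | side s u]| => a0 a1 <-.
by have [agm _] := nat_AGM2 a0 a1; rewrite -[(#|Block| ^ 2)%N]mulnn; lia.
Qed.

(* Flipping a forgotten input of the gate read at [x] changes [hard_fun w G]
   but not [g]. *)
Lemma prob_touching_le_dist w s G (g : boolfun n) (S : {set Block * bool}) :
  {in S, forall u, ~~ depends_on g (active w u)} ->
  \P_(x ~ cube_law R n) ((G (control_part w x)).1 \in opposite_touching s S) <=
  2 * dist R (hard_fun w G) g.
Proof.
move=> g_ignores.
pose input x := let d := G (control_part w x) in
  if d.1.1 \in S then d.1.1 else d.1.2.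
pose phi x := flip (active w (input x)) x.
have cp_phi x : control_part w (phi x) = control_part w x.
  by apply: control_part_flip; exact: active_notin_control.
have phiK : involutive phi.
  by move=> x; rewrite {1}/phi /input cp_phi flip_involutive.
apply: (@prob_le_2dist _ _ _ _ _ phi (inv_inj phiK)) => x;
  rewrite inE => /andP[opp touch].
  have inputs_neq : (G (control_part w x)).1.1 != (G (control_part w x)).1.2.
    by apply: contraTneq opp; rewrite /opposite => ->; rewrite addbb.
  rewrite ![hard_fun _ _ _]ffunE cp_phi /gate_value /phi /input.
  case: ifP => _; rewrite flip_eq flip_neq ?(inj_eq (@active_inj w)) //.
  - by rewrite addNb addbN.
  - by rewrite eq_sym.
  - by rewrite !addbN.
by apply/independent_flip/g_ignores; rewrite /input; case: ifP touch.
Qed.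

Lemma gate_freq_touching_le_dist w s G (g : boolfun n)
    (S : {set Block * bool}) (eps : R) :
  gates_equidistributed w s G eps ->
  {in S, forall u, ~~ depends_on g (active w u)} ->
  #|opposite_touching s S|%:R * ((2 * h ^+ 2)^-1 - eps) <=
  2 * dist R (hard_fun w G) g.
Proof.
move=> /forallP equi g_ignores.
apply: le_trans (prob_touching_le_dist s G g_ignores).
have -> : \P_(x ~ cube_law R n)
      ((G (control_part w x)).1 \in opposite_touching s S) =
    \sum_(uu in opposite_touching s S) gate_freq w G uu.
  under [RHS]eq_bigr do rewrite /gate_freq probE.
  rewrite -expect_sum probE; apply: eq_expect => x.
  have [inA|notinA] := boolP (_ \in opposite_touching s S).
    rewrite (bigD1 _ inA) /= eqxx big1 ?addr0 // => uu /andP[_ /negPf].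
    by rewrite eq_sym => ->.
  by rewrite big1 // => uu; case: eqP => // <-; rewrite (negPf notinA).
rewrite mulr_natl -sumr_const; apply: ler_sum => uu.
rewrite inE => /andP[suu _].
by have := equi uu; rewrite suu ler_norml => /andP[+ _]; lra.
Qed.

Lemma far_of_forgotten_inputs w s G (g : boolfun n) (S : {set Block * bool}) :
  gates_equidistributed w s G (20 * h ^+ 2)^-1 ->
  {in S, forall u, ~~ depends_on g (active w u)} ->
  (100 * #|~: S| <= 101 * #|Block|)%N -> 5 / 16 < dist R (hard_fun w G) g.
Proof.
move=> equi g_ignores; have h_gt0 := natr_card_Block_gt0.
have h2_gt0 : 0 < h ^+ 2 by rewrite exprn_gt0.
have := gate_freq_touching_le_dist equi g_ignores.
have -> : (2 * h ^+ 2)^-1 - (20 * h ^+ 2)^-1 = 9 / 20 / h ^+ 2.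
  by field; rewrite gt_eqF.
have := card_opposite_touching s S.
rewrite mulrA ler_pdivrMr // -!(ler_nat R) natrD !natrM.
have : 0 <= #|~: S|%:R :> R by [].
move: #|~: S| #|opposite_touching s S| => c t c_ge0 card_t freq_t c_le.
have c2_le : c%:R ^+ 2 <= (101 / 100 * h) ^+ 2.
  by rewrite ler_pXn2r ?nnegrE //; lra.
rewrite -(ltr_pM2r h2_gt0); rewrite exprMn in c2_le; lra.
Qed.

Lemma far_of_ignored_controls w G (g : boolfun n) (D : {set 'I_n}) :
  flips_decorrelated w G (1 / 20) -> D \subset control w -> (16 <= #|D|)%N ->
  {in D, forall c, ~~ depends_on g c} -> 5 / 16 < dist R (hard_fun w G) g.
Proof.
move=> /forall_inP decorr /subsetP Dw D_ge16 g_ignores.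
have D_gt0 : (0 < #|D|)%N by lia.
have D_inv : #|D|%:R^-1 <= 1 / 16 :> R.
  by rewrite div1r lef_pV2 ?posrE ?ltr0n // ler_nat.
suff corr : {in D &, forall c c',
    flip_corr R (hard_fun w G) c c' <= (c == c')%:R + 1 / 20}.
  by have := sqr_sign_corr_le D_gt0 g_ignores corr; nra.
move=> c c' cD c'D; have [->|cc'] := eqVneq c c'.
  have -> : flip_corr R (hard_fun w G) c' c' = 1.
    rewrite -[RHS](expect_cst (cube_law R n)); apply: eq_expect => x.
    by rewrite -expr2 sqrr_sign.
  by rewrite lerDl divr_ge0.
have /forall_inP/(_ _ (Dw _ c'D)) := decorr _ (Dw _ cD).
by rewrite cc' add0r.
Qed.

Lemma card_active_or_control_le w (J : {set 'I_n}) :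
  (2 * #|Pair| * #|Block| <=
   #|J| + #|control w :\: J| + #|[set u | active w u \notin J]|)%N.
Proof.
set S := [set u | _].
have cover : coord @: [set: Block * Pair * bool] \subset
    J :|: (control w :\: J) :|: active w @: S.
  apply/subsetP => _ /imsetP[[[b c] t] _ ->]; rewrite !in_setU !in_setD.
  have [//|/=] := boolP (coord _ \in J).
  case: (coord_active_or_control w b c t) => [-> //|-> notJ].
  by rewrite imset_f ?orbT // inE.
have -> : (2 * #|Pair| * #|Block| = #|coord @: [set: Block * Pair * bool]|)%N.
  by rewrite card_imset // cardsT !card_prod card_bool; lia.
apply: leq_trans (subset_leq_card cover) _.
apply: leq_trans (leq_card_setU _ _) (leq_add _ (leq_imset_card _ _)).
exact: leq_card_setU.
Qed.

Lemma typical_opposite_far w s G k r :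
  gates_equidistributed w s G (20 * h ^+ 2)^-1 ->
  flips_decorrelated w G (1 / 20) ->
  (k + #|Block| <= 2 * #|Pair| * #|Block| + r)%N ->
  (100 * (r + 15) <= #|Block|)%N ->
  5 / 16 < dist_class R (hard_fun w G) (juntas n k).
Proof.
move=> equi decorr k_le r_le; apply: lt_dist_class => [|g]; first by lra.
rewrite inE; set J := [set i | depends_on g i] => J_le.
have notJ i : i \notin J -> ~~ depends_on g i by rewrite inE.
have [few|many] := ltnP #|control w :\: J| 16; last first.
  by apply: (far_of_ignored_controls decorr _ many) => [|c /setDP[_ /notJ] //];
    exact: subsetDl.
pose S := [set u | active w u \notin J].
apply: (far_of_forgotten_inputs (S := S) equi) => [u|].
  by rewrite inE => /notJ.
have := cardsC S; rewrite card_prod card_bool.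
have := card_active_or_control_le w J; rewrite -/S.
move: J_le few k_le r_le; clear.
move: #|Block| #|Pair| #|J| #|S| #|~: S| #|_ :\: _| => *; lia.
Qed.

Lemma prob_opposite_not_far_le w s k r :
  (k + #|Block| <= 2 * #|Pair| * #|Block| + r)%N ->
  (100 * (r + 15) <= #|Block|)%N ->
  \P_(G ~ circuit_law true s)
     ~~ (5 / 16 < dist_class R (hard_fun w G) (juntas n k)) <=
  (1600 * h ^+ 6 + 800 * #|control w|%:R ^+ 2) / 2 ^+ #|control w|.
Proof.
move=> k_le r_le; have h_gt0 := natr_card_Block_gt0.
have pow_gt0 : 0 < 2 ^+ #|control w| :> R by rewrite exprn_gt0.
have eps_gt0 : 0 < (20 * h ^+ 2)^-1 by rewrite invr_gt0 mulr_gt0 // exprn_gt0.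
have delta_gt0 : 0 < 1 / 20 :> R by lra.
have <- : 4 * h ^+ 2 * ((2 ^+ #|control w|)^-1 / (20 * h ^+ 2)^-1 ^+ 2) +
    #|control w|%:R ^+ 2 * (2 / 2 ^+ #|control w| / (1 / 20) ^+ 2) =
    (1600 * h ^+ 6 + 800 * #|control w|%:R ^+ 2) / 2 ^+ #|control w|.
  by field; rewrite !gt_eqF.
apply: le_trans (lerD (prob_gates_not_equidistributed_le w s eps_gt0)
                      (prob_flips_correlated_le true w s delta_gt0)).
apply: le_trans (prob_or_le _ _ _); apply: le_prob => G.
apply: contraNT; rewrite negb_or !negbK => /andP[equi decorr].
exact: typical_opposite_far equi decorr k_le r_le.
Qed.

(** * Indistinguishability *)

Section Queries.
Variables (w : {ffun Block -> Pair}) (q : nat) (Q : q.-tuple (cube n)).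
Variable V : q.-tuple bool -> bool.

Definition accept_prob tau s : R :=
  \P_(G ~ circuit_law tau s) V (map_tuple (hard_fun w G) Q).

Definition in_cell (z : cube n) (i : 'I_q) : bool :=
  control_part w (tnth Q i) == z.

Definition live_blocks (z : cube n) : {set Block} :=
  [set b | [exists i in in_cell z, exists j in in_cell z,
     [exists t, tnth Q i (active w (b, t)) != tnth Q j (active w (b, t))]]].

Definition live z d : bool :=
  (d.1.1.1 \in live_blocks z) && (d.1.2.1 \in live_blocks z).

Definition response z d : {ffun 'I_q -> bool} :=
  [ffun i => in_cell z i && gate_value w d (tnth Q i)].

Lemma dead_block_eq z b t i j :
  b \notin live_blocks z -> in_cell z i -> in_cell z j ->
  tnth Q i (active w (b, t)) = tnth Q j (active w (b, t)).
Proof.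
move=> dead iz jz; apply: contraNeq dead => ij; rewrite inE.
apply/exists_inP; exists i => //; apply/exists_inP; exists j => //.
by apply/existsP; exists t.
Qed.

(* Moving an endpoint within a dead block changes every answer of the cell by
   the same amount, which the output bit of the gate absorbs; [gate_sign]
   changes sign. *)
Lemma sum_gate_sign_dead_fst s z e (P : pred Block) :
  \sum_(d | [&& response z d == e, d.1.1.1 \notin live_blocks z & P d.1.2.1])
     gate_sign s d = 0.
Proof.
pose x0 : cube n := if [pick i | in_cell z i] is Some i then tnth Q i
  else [ffun=> false].
pose swap d : gate := ((d.1.1.1, ~~ d.1.1.2), d.1.2,
  d.2 (+) (x0 (active w d.1.1) (+) x0 (active w (d.1.1.1, ~~ d.1.1.2)))).
have swapK : involutive swap.
  move=> [[[b t] u] r]; rewrite /swap /= negbK; congr (_, _, _).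
  by rewrite [x0 _ (+) x0 (active w (b, t))]addbC addbK.
have response_swap d :
    d.1.1.1 \notin live_blocks z -> response z (swap d) = response z d.
  move=> dead; apply/ffunP => i; rewrite !ffunE.
  case: (boolP (in_cell z i)) => //= iz.
  have x0E t : x0 (active w (d.1.1.1, t)) = tnth Q i (active w (d.1.1.1, t)).
    rewrite /x0; case: pickP => [j jz|/(_ i)]; last by rewrite iz.
    exact: dead_block_eq dead jz iz.
  move: dead x0E; case: d => [[[b t] u] r] /= _ x0E.
  rewrite /gate_value /= !x0E.
  by case: r; case: (tnth Q i _); case: (tnth Q i _); case: (tnth Q i _).
apply: (sum_odd_eq0 (inv_inj swapK)) => d.
  case: (boolP (d.1.1.1 \in live_blocks z)) => dead; first by rewrite !andbF.
  by rewrite response_swap.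
by rewrite /gate_sign /opposite /side /= !addNb signrN.
Qed.

Lemma sum_gate_sign_dead_snd s z e (P : pred Block) :
  \sum_(d | [&& response z d == e, d.1.2.1 \notin live_blocks z & P d.1.1.1])
     gate_sign s d = 0.
Proof.
pose swap d : gate := (d.1.2, d.1.1, d.2).
have swapK : involutive swap by move=> [[u v] r].
rewrite (reindex_inj (inv_inj swapK)) /= -[RHS](sum_gate_sign_dead_fst s z e P).
apply: eq_big => [d|d _]; last by rewrite /gate_sign /opposite addbC.
congr (_ && _); congr (_ == _); apply/ffunP => i.
by rewrite !ffunE /gate_value /= [X in _ (+) X]addbC.
Qed.

Lemma sum_gate_sign_dead s z e :
  \sum_(d | (response z d == e) && ~~ live z d) gate_sign s d = 0.
Proof.
rewrite (bigID (fun d => d.1.1.1 \in live_blocks z)) /=.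
rewrite [X in X + _](_ : _ = 0) ?[X in _ + X](_ : _ = 0) ?addr0 //.
  rewrite -[RHS](sum_gate_sign_dead_fst s z e predT); apply: eq_bigl => d.
  rewrite /live.
  by case: (_ == e); case: (d.1.1.1 \in _); case: (d.1.2.1 \in _).
rewrite -[RHS](sum_gate_sign_dead_snd s z e (fun b => b \in live_blocks z)).
apply: eq_bigl => d; rewrite /live.
by case: (_ == e); case: (d.1.1.1 \in _); case: (d.1.2.1 \in _).
Qed.

Definition live_density tau s z d : R :=
  1 + (-1) ^+ tau * ((live z d)%:R * gate_sign s d).

Lemma sum_gate_law_response tau s z e :
  \sum_(d | response z d == e) gate_law tau s d =
  \sum_(d | response z d == e) uniform_gate d * live_density tau s z d.
Proof.
apply/eqP; rewrite -subr_eq0 -sumrB; apply/eqP.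
transitivity (#|gate|%:R^-1 * ((-1) ^+ tau *
    \sum_(d | (response z d == e) && ~~ live z d) gate_sign s d)); last first.
  by rewrite sum_gate_sign_dead !mulr0.
rewrite big_mkcondr !mulr_sumr; apply: eq_bigr => d _.
rewrite /= /gate_weight /live_density /=.
by case: (live z d); rewrite /= ?mulr1n ?mulr0n; ring.
Qed.

Lemma accept_prob_live tau s :
  accept_prob tau s = \E_(G ~ prod_pmf (fun _ : cube n => uniform_gate))
    ((\prod_z live_density tau s z (G z)) *
     (V (map_tuple (hard_fun w G) Q))%:R).
Proof.
pose Phi (r : {ffun cube n -> {ffun 'I_q -> bool}}) : R :=
  (V [tuple r (control_part w (tnth Q i)) i | i < q])%:R.
have PhiE G : (V (map_tuple (hard_fun w G) Q))%:R =
    Phi [ffun z => response z (G z)].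
  congr ((V _)%:R); apply: eq_from_tnth => i.
  by rewrite tnth_map tnth_mktuple !ffunE /in_cell eqxx.
rewrite /accept_prob probE /expect.
under eq_bigr do rewrite PhiE.
under [RHS]eq_bigr do rewrite PhiE mulrA -big_split.
exact: eq_sum_ffun_prod_fiber (sum_gate_law_response tau s).
Qed.

Lemma expect_live_sign s z :
  \E_(d ~ uniform_gate)
    (1 + (live z d)%:R * sign_monomial R s [:: d.1.1.1; d.1.2.1]) =
  1 + h ^- 2 * (\sum_(b in live_blocks z) (-1) ^+ s b) ^+ 2.
Proof.
rewrite expectD expect_cst; congr (_ + _).
pose F b : R := (b \in live_blocks z)%:R * (-1) ^+ s b.
transitivity (\E_(d ~ uniform_gate) (F d.1.1.1 * F d.1.2.1)).
  apply: eq_expect => d; rewrite /F /live /sign_monomial !big_cons big_nil.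
  by rewrite -mulnb natrM; ring.
have sum_pair_bool (I : finType) (f : I -> R) :
    \sum_(p : I * bool) f p.1 = 2 * \sum_i f i.
  rewrite -(pair_bigA _ (fun i (t : bool) => f i)) /= mulr_sumr.
  by apply: eq_bigr => i _; rewrite big_bool /=; ring.
rewrite expect_uniform card_gate.
rewrite (sum_pair_bool _
  (fun uu : (Block * bool) * (Block * bool) => F uu.1.1 * F uu.2.1)).
rewrite -(pair_bigA _ (fun u v : Block * bool => F u.1 * F v.1)) /=.
under eq_bigr do rewrite -mulr_sumr.
rewrite -mulr_suml !sum_pair_bool.
have -> : \sum_(b in live_blocks z) (-1) ^+ s b = \sum_b F b.
  rewrite big_mkcond; apply: eq_bigr => b _.
  by rewrite /F; case: (b \in _); rewrite ?mul1r ?mul0r.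
by field; rewrite gt_eqF // natr_card_Block_gt0.
Qed.

Lemma accept_prob_diff_le :
  `|\E_(s ~ signs R Block) accept_prob false s -
    \E_(s ~ signs R Block) accept_prob true s| <=
  2 * (\E_(s ~ signs R Block) \prod_z
         (1 + h ^- 2 * (\sum_(b in live_blocks z) (-1) ^+ s b) ^+ 2) - 1).
Proof.
pose k tau G z : R :=
  (-1) ^+ tau * ((live z (G z))%:R * (-1) ^+ ((G z).1.1.2 (+) (G z).1.2.2)).
pose l G z := [:: (G z).1.1.1; (G z).1.2.1].
pose law := prod_pmf (fun _ : cube n => uniform_gate).
have k_le tau G z : `|k tau G z| <= (live z (G z))%:R.
  by rewrite !normrM !normr_sign mul1r mulr1 ger0_norm.
have densityE tau s G z : live_density tau s z (G z) =
    1 + k tau G z * sign_monomial R s (l G z).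
  rewrite /live_density /k /gate_sign /opposite /side.
  rewrite /sign_monomial !big_cons big_nil.
  by rewrite !signr_addb mulr1 [X in _ + _ * (_ * X) = _]mulrACA !mulrA.
have acceptE tau : \E_(s ~ signs R Block) accept_prob tau s =
    \E_(G ~ law) ((V (map_tuple (hard_fun w G) Q))%:R * \E_(s ~ signs R Block)
      \prod_z (1 + k tau G z * sign_monomial R s (l G z))).
  under [LHS]eq_expect do rewrite accept_prob_live.
  rewrite exchange_expect; apply: eq_expect => G; rewrite -expectZl.
  by apply: eq_expect => s; rewrite mulrC; under eq_bigr do rewrite densityE.
have <- : \E_(G ~ law) \E_(s ~ signs R Block)
      \prod_z (1 + (live z (G z))%:R * sign_monomial R s (l G z)) =
    \E_(s ~ signs R Block) \prod_z
      (1 + h ^- 2 * (\sum_(b in live_blocks z) (-1) ^+ s b) ^+ 2).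
  rewrite exchange_expect; apply: eq_expect => s.
  under [RHS]eq_bigr do rewrite -expect_live_sign.
  by rewrite -expect_prod_pmf.
rewrite !acceptE -expectB -[X in _ <= _ * (_ - X)](expect_cst law).
rewrite -expectB -expectZl; apply: le_trans (norm_expect_le _ _) _.
apply: le_expect => G _; rewrite -mulrBr normrM -[leRHS]mul1r.
apply: ler_pM => //; first by case: (V _); rewrite ?normr1 ?normr0.
exact: expect_prod_sign_monomial_diff_le.
Qed.

End Queries.

Definition block_diff (x y : cube n) : {set Block} :=
  [set b | [exists c, exists t, x (coord (b, c, t)) != y (coord (b, c, t))]].

Lemma control_part_eq_selects w x y b c t :
  control_part w x = control_part w y ->
  x (coord (b, c, t)) != y (coord (b, c, t)) -> w b = c.
Proof.
move=> xy; apply: contraNeq => wbc; move/ffunP/(_ (coord (b, c, t))): xy.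
have inw : coord (b, c, t) \in control w.
  by apply: imset_f; rewrite inE /= eq_sym.
by rewrite !ffunE inw /= => ->.
Qed.

Lemma card_control_part_eq x y :
  (#|[pred w | control_part w x == control_part w y]| *
   #|Pair| ^ #|block_diff x y| <= #|{ffun Block -> Pair}|)%N.
Proof.
pose wit b := [pick c | [exists t, x (coord (b, c, t)) != y (coord (b, c, t))]].
pose F b : {set Pair} := if wit b is Some c then [set c] else setT.
have sub : [pred w | control_part w x == control_part w y] \subset setXn F.
  apply/subsetP => w; rewrite inE => /eqP xy; apply/setXnP => b.
  rewrite /F /wit; case: pickP => [c /existsP[t neq]|_]; last by rewrite inE.
  by rewrite inE; apply/eqP; exact: control_part_eq_selects neq.
apply: leq_trans (leq_mul (subset_leq_card sub) (leqnn _)) _.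
rewrite cardsXn -prod_nat_const [X in (_ * X)%N]big_mkcond -big_split /=.
rewrite card_ffun -prod_nat_const; apply: leq_prod => b _.
rewrite /F /wit inE; case: pickP => [c cP|none].
  by rewrite cards1 mul1n; case: existsP => // -[]; exists c.
case: existsP => [[c]|_]; first by rewrite none.
by rewrite muln1; exact: max_card.
Qed.

Section RandomSelection.
Hypothesis Pair_gt1 : (1 < #|Pair|)%N.

Lemma selection_gt0 : (0 < #|{ffun Block -> Pair}|)%N.
Proof. by rewrite card_ffun expn_gt0 ltnW. Qed.

Definition selection_law : pmf R {ffun Block -> Pair} :=
  uniform R selection_gt0.

Lemma prob_control_part_eq_le x y :
  \P_(w ~ selection_law) (control_part w x == control_part w y) <=
  (2 ^+ #|block_diff x y|)^-1.
Proof.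
have natr_Pair_gt0 : 0 < #|Pair|%:R :> R by rewrite ltr0n ltnW.
apply: (@le_trans _ _ (#|Pair|%:R ^+ #|block_diff x y|)^-1); last first.
  by rewrite lef_pV2 ?posrE ?exprn_gt0 // lerXn2r ?nnegrE ?ler_nat // ltW.
rewrite prob_uniform ler_pdivrMr ?natr_card_gt0 ?selection_gt0 // mulrC.
by rewrite ler_pdivlMr ?exprn_gt0 // -natrX -natrM ler_nat card_control_part_eq.
Qed.

Variables (q : nat) (Q : q.-tuple (cube n)) (t : nat).

Definition spread w : bool :=
  [exists ij : 'I_q * 'I_q,
     (control_part w (tnth Q ij.1) == control_part w (tnth Q ij.2)) &&
     (t < #|block_diff (tnth Q ij.1) (tnth Q ij.2)|)%N].

Lemma prob_spread_le : prob selection_law spread <= q%:R ^+ 2 / 2 ^+ t.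
Proof.
apply: le_trans (prob_union_le _ (fun w => elimT existsP)) _.
apply: (@le_trans _ _ (\sum_(ij : 'I_q * 'I_q) (2 ^+ t)^-1)); last first.
  by rewrite sumr_const card_prod card_ord -[leLHS]mulr_natl natrM expr2.
apply: ler_sum => ij _; have [far|_] := ltnP t; last first.
  by rewrite /prob big_pred0 ?invr_ge0 ?exprn_ge0 // => w; rewrite andbF.
apply: le_trans (le_prob _ _) (le_trans (prob_control_part_eq_le _ _) _).
  by move=> w /andP[eq_cp _]; exact: eq_cp.
by rewrite lef_pV2 ?posrE ?exprn_gt0 // ler_weXn2l ?ler1n // ltnW.
Qed.

Lemma card_live_blocks_le w z :
  ~~ spread w -> (#|live_blocks w Q z| <= \sum_(i < q | in_cell w Q z i) t)%N.
Proof.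
move=> /existsPn not_spread.
have [i0 i0z|none] := pickP (in_cell w Q z); last first.
  rewrite [live_blocks _ _ _](_ : _ = set0) ?cards0 //; apply/setP => b.
  by rewrite !inE; apply/exists_inP => -[i]; rewrite [_ \in _]none.
have sub : live_blocks w Q z \subset
    \bigcup_(i < q | in_cell w Q z i) block_diff (tnth Q i) (tnth Q i0).
  apply/subsetP => b.
  rewrite inE => /exists_inP[i iz /exists_inP[j jz /existsP[t' ij]]].
  have in_union l : in_cell w Q z l ->
      tnth Q l (active w (b, t')) != tnth Q i0 (active w (b, t')) ->
      b \in \bigcup_(i < q | in_cell w Q z i) block_diff (tnth Q i) (tnth Q i0).
    move=> lz neq; apply/bigcupP; exists l => //; rewrite inE.
    by apply/existsP; exists (w b); apply/existsP; exists t'.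
  have [eq_i|] := eqVneq (tnth Q i (active w (b, t')))
                         (tnth Q i0 (active w (b, t'))).
    by apply: (in_union j) => //; rewrite -eq_i eq_sym.
  exact: in_union.
apply: leq_trans (subset_leq_card sub) (leq_trans (card_bigcup_le _ _) _).
apply: leq_sum => i /eqP iz.
by have := not_spread (i, i0); rewrite /= iz (eqP i0z) eqxx /= -leqNgt.
Qed.

Lemma sum_card_live_blocks_le w :
  ~~ spread w -> (\sum_z #|live_blocks w Q z| <= q * t)%N.
Proof.
move=> not_spread.
apply: (@leq_trans (\sum_z \sum_(i < q | in_cell w Q z i) t)).
  by apply: leq_sum => z _; exact: card_live_blocks_le.
rewrite (exchange_big_dep xpredT) //= -[X in (_ <= X * _)%N]card_ord
  -sum_nat_const.
apply: leq_sum => i _.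
by rewrite (big_pred1 (control_part w (tnth Q i))) // => z; exact: eq_sym.
Qed.

Lemma accept_prob_diff_not_spread w (V : q.-tuple bool -> bool) (eta : R) :
  ~~ spread w -> (q * t)%:R <= eta * h ^+ 2 -> 32 * eta <= 1 ->
  \E_(s ~ signs R Block) accept_prob w Q V false s -
  \E_(s ~ signs R Block) accept_prob w Q V true s <= 2 * (expR (2 * eta) - 1).
Proof.
move=> not_spread qt_le eta_le.
have h2_gt0 : 0 < h ^+ 2 by rewrite exprn_gt0 // ltr0n.
have total : h ^- 2 * \sum_z #|live_blocks w Q z|%:R <= eta.
  rewrite mulrC ler_pdivrMr //; apply: le_trans qt_le.
  by rewrite -natr_sum ler_nat sum_card_live_blocks_le.
apply: le_trans (ler_norm _) _; apply: le_trans (accept_prob_diff_le _ _ _) _.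
rewrite ler_pM2l // lerD2r.
have c_ge0 : 0 <= h ^- 2 by rewrite invr_ge0 ltW.
apply: le_trans (expect_prod_sqr_sum_sign c_ge0 _) _; first by lra.
by rewrite ler_expR ler_pM2l.
Qed.

Lemma accept_prob_gap (V : q.-tuple bool -> bool) (eta : R) :
  (q * t)%:R <= eta * h ^+ 2 -> 32 * eta <= 1 ->
  \E_(w ~ selection_law) \E_(s ~ signs R Block) accept_prob w Q V false s -
  \E_(w ~ selection_law) \E_(s ~ signs R Block) accept_prob w Q V true s <=
  q%:R ^+ 2 / 2 ^+ t + 2 * (expR (2 * eta) - 1).
Proof.
move=> qt_le eta_le; have h2_gt0 : 0 < h ^+ 2 by rewrite exprn_gt0 // ltr0n.
have eta_ge0 : 0 <= eta.
  by have := le_trans (ler0n R _) qt_le; rewrite pmulr_lge0.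
have expR_ge1 : 0 <= expR (2 * eta) - 1.
  by rewrite subr_ge0; apply: le_trans (expR_ge1Dx _); rewrite lerDl mulr_ge0.
apply: le_trans (lerD prob_spread_le (lexx _)).
rewrite -expectB probE -[X in _ + X](expect_cst selection_law) -expectD.
apply: le_expect => w _; have [_|not_spread] := boolP (spread w); last first.
  by rewrite add0r; exact: accept_prob_diff_not_spread.
apply: (@le_trans _ _ 1); last by rewrite lerDl mulr_ge0.
rewrite -expectB -[leRHS](expect_cst (signs R Block)); apply: le_expect => s _.
by apply: le_trans (lerB (prob_le1 _ _) (prob_ge0 _ _)) _; rewrite subr0.
Qed.

Definition hard_law (tau : bool) :
    pmf R ({ffun Block -> Pair} * {ffun Block -> bool} * circuit)%type :=
  dpair_pmf (dpair_pmf selection_law (fun=> signs R Block))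
            (fun ws => circuit_law tau ws.2).

Lemma expect_hard_law tau
    (F : {ffun Block -> Pair} -> {ffun Block -> bool} -> circuit -> R) :
  \E_(o ~ hard_law tau) F o.1.1 o.1.2 o.2 =
  \E_(w ~ selection_law) \E_(s ~ signs R Block)
    \E_(G ~ circuit_law tau s) F w s G.
Proof.
rewrite (expect_dpair_pmf _ _ (fun ws G => F ws.1 ws.2 G)).
exact: (expect_dpair_pmf _ _ (fun w s => \E_(G ~ circuit_law tau s) F w s G)).
Qed.

End RandomSelection.

Lemma tolerant_junta_tester_advantage q (T : nonadaptive_tester R n q) k t
    (eps1 eta p : R) :
  (1 < #|Pair|)%N ->
  is_tolerant_tester (1 / 4) eps1 (juntas n k) T ->
  (2 * #|Pair| * #|Block| <= k + #|Block|)%N ->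
  (forall w s, \P_(G ~ circuit_law true s)
     ~~ (eps1 < dist_class R (hard_fun w G) (juntas n k)) <= p) ->
  (q * t)%:R <= eta * h ^+ 2 -> 32 * eta <= 1 ->
  1 / 3 <= p + (q%:R ^+ 2 / 2 ^+ t + 2 * (expR (2 * eta) - 1)).
Proof.
move=> Pair_gt1 T_tolerant k_ge far qt_le eta_le.
apply: (tolerant_tester_advantage T_tolerant
  (yes := hard_law Pair_gt1 false) (no := hard_law Pair_gt1 true)
  (F := fun o => hard_fun o.1.1 o.2)).
- move=> [[w s] G]; rewrite mulf_eq0 negb_or => /andP[_ G_neq0].
  apply: (same_side_close (s := s) w _ k_ge) => z.
  by rewrite (circuit_law_opposite G_neq0).
- rewrite probE (expect_hard_law _ _ (fun w s G =>
    (~~ (eps1 < dist_class R (hard_fun w G) (juntas n k)))%:R)).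
  rewrite -[leRHS](expect_cst (selection_law Pair_gt1)).
  apply: le_expect => w _.
  rewrite -[leRHS](expect_cst (signs R Block)); apply: le_expect => s _.
  by rewrite -probE.
- move=> Q V.
  have acceptE tau :
      \P_(o ~ hard_law Pair_gt1 tau) V (map_tuple (hard_fun o.1.1 o.2) Q) =
      \E_(w ~ selection_law Pair_gt1) \E_(s ~ signs R Block)
        accept_prob w Q V tau s.
    rewrite probE (expect_hard_law _ _ (fun w s G =>
      (V (map_tuple (hard_fun w G) Q))%:R)).
    by apply: eq_expect => w; apply: eq_expect => s; rewrite -probE.
  by rewrite !acceptE; exact: accept_prob_gap.
Qed.

End Laws.
End HardFunctions.

(** * The lower bound *)

Lemma exists_injective_ord (T : finType) n :
  (#|T| <= n)%N -> exists f : T -> 'I_n, injective f.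
Proof.
move=> Tn; exists (fun x => widen_ord Tn (enum_rank x)) => x y.
by move=> /(congr1 val) /= /val_inj /enum_rank_inj.
Qed.

Lemma pow6_le_exp4 (R : realFieldType) m :
  (64 <= m)%N -> 48 * 1000 * m%:R ^+ 6 <= 4 ^+ m :> R.
Proof.
elim: m => // m IH; rewrite leq_eqVlt => /orP[/eqP <-|]; first by lra.
rewrite ltnS => m_ge64; have {}IH := IH m_ge64.
have m_ge : 64 <= m%:R :> R by rewrite ler_nat.
have : m.+1%:R <= 5 / 4 * m%:R :> R by rewrite -natr1; lra.
move=> ratio; have : m.+1%:R ^+ 6 <= (5 / 4 * m%:R) ^+ 6 :> R.
  by rewrite ler_pXn2r // nnegrE ?ler0n //; lra.
have : 0 <= m%:R ^+ 6 :> R by rewrite exprn_ge0.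
by rewrite exprMn (exprS 4 m); lra.
Qed.

Lemma atypical_prob_le (R : realFieldType) (b m c : nat) :
  (64 <= m)%N -> (2 <= b <= m)%N -> (c + 2 * m = 2 * b * m)%N ->
  (1600 * m%:R ^+ 6 + 800 * c%:R ^+ 2) / 2 ^+ c <= 1 / 10 :> R.
Proof.
move=> m_ge64 /andP[b_ge2 b_le_m] c_eq.
have c_ge : (2 * m <= c)%N by nia.
have c_le : (c <= 2 * m ^ 2)%N by rewrite -mulnn; nia.
have exp_ge : 4 ^+ m <= 2 ^+ c :> R.
  have -> : 4 = 2 ^+ 2 :> R by rewrite expr2; lra.
  by rewrite -exprM ler_weXn2l // ler1n.
have c2_le : c%:R ^+ 2 <= 4 * m%:R ^+ 6 :> R.
  have m_ge1 : 1 <= m%:R :> R by rewrite ler1n (leq_trans _ m_ge64).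
  apply: (@le_trans _ _ ((2 * m%:R ^+ 2) ^+ 2)).
    rewrite ler_pXn2r ?nnegrE ?ler0n ?mulr_ge0 ?exprn_ge0 //.
    by rewrite -natrX -natrM ler_nat.
  rewrite exprMn -exprM.
  have : m%:R ^+ 4 <= m%:R ^+ 6 :> R by rewrite ler_weXn2l.
  rewrite /=; lra.
rewrite ler_pdivrMr ?exprn_gt0 //.
have := pow6_le_exp4 R m_ge64; lra.
Qed.

Lemma up_log2_le (R : realType) (k : nat) :
  (1 < k)%N -> (up_log 2 k)%:R <= 1 + ln (k%:R ^+ 2) :> R.
Proof.
move=> k_gt1; have k_gt0 : 0 < k%:R :> R by rewrite ltr0n ltnW.
have /andP[log_lo _] := up_log_bounds (isT : (1 < 2)%N) k_gt1.
have ln2_ge : 1 / 2 <= ln 2 :> R.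
  rewrite -ler_expR lnK ?posrE //.
  have half_lt1 : 1 / 2 < 1 :> R by lra.
  have := expR_le_invB half_lt1.
  by rewrite -[X in _ <= X]mul1r ler_pdivlMr; lra.
have : 2 ^+ (up_log 2 k).-1 <= k%:R :> R by rewrite -natrX ler_nat ltnW.
rewrite -ler_ln ?posrE ?exprn_gt0 // !lnXn //.
rewrite -[ln 2 *+ _]mulr_natl -[ln k%:R *+ 2]mulr_natl => log_le.
have -> : (up_log 2 k)%:R = (up_log 2 k).-1%:R + 1 :> R.
  by rewrite natr1 prednK // up_log_gt0.
have : 0 <= (up_log 2 k).-1%:R :> R by [].
nra.
Qed.

(* [m] blocks of [b] pairs each. *)
Lemma junta_tester_queries_gt (R : realType) (b m r n k q t : nat)
    (T : nonadaptive_tester R n q) :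
  (2 <= b <= m)%N -> (2 * b * m <= n)%N -> (2 * b * m <= k + m)%N ->
  (k + m <= 2 * b * m + r)%N -> (100 * (r + 15) <= m)%N ->
  is_tolerant_tester (1 / 4) (5 / 16) (juntas n k) T ->
  (128 * q ^ 2 <= 2 ^ t)%N -> (m ^ 2 < 100 * (q * t))%N.
Proof.
move=> b_le_m fits k_ge k_le m_ge T_tolerant q2_le.
rewrite ltnNge; apply/negP => m2_ge.
have coord_fits : (#|{: 'I_m * 'I_b * bool}| <= n)%N.
  by rewrite !card_prod !card_ord card_bool; lia.
have [coord coord_inj] := exists_injective_ord coord_fits.
have m_gt0 : (0 < #|'I_m|)%N by rewrite card_ord; lia.
have b_gt1 : (1 < #|'I_b|)%N by rewrite card_ord; lia.
have advantage : 1 / 3 <=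
    1 / 10 + (q%:R ^+ 2 / 2 ^+ t + 2 * (expR (2 * (1 / 100)) - 1)) :> R.
  apply: (tolerant_junta_tester_advantage coord_inj
    (Block_gt0 := m_gt0) b_gt1 T_tolerant); last by lra.
  - by rewrite !card_ord.
  - move=> w s.
    have c_eq := card_control coord_inj w; rewrite !card_ord in c_eq.
    have not_far :=
      prob_opposite_not_far_le coord_inj R m_gt0 w s (k := k) (r := r).
    apply: le_trans (not_far _ _) _; rewrite !card_ord //.
    by apply: (atypical_prob_le _ _ b_le_m c_eq); lia.
  - by rewrite card_ord; move: m2_ge; rewrite -(ler_nat R) natrM natrX; lra.
have expR_small : expR (2 * (1 / 100)) <= 50 / 49 :> R.
  have -> : 50 / 49 = (1 - 2 * (1 / 100))^-1 :> R by field.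
  by apply: expR_le_invB; lra.
have : q%:R ^+ 2 / 2 ^+ t <= 1 / 128 :> R.
  rewrite ler_pdivrMr ?exprn_gt0 //.
  by move: q2_le; rewrite -(ler_nat R) natrM !natrX; lra.
lra.
Qed.

Lemma junta_tester_lower_bound_large (R : realType) (b n k q : nat)
    (T : nonadaptive_tester R n q) :
  (2 <= b)%N -> (100 * (2 * b + 13) <= k %/ (2 * b).-1)%N ->
  (2 * b * (k %/ (2 * b).-1) <= n)%N ->
  is_tolerant_tester (1 / 4) (5 / 16) (juntas n k) T ->
  k%:R ^+ 2 / Num.max 1 (ln (k%:R ^+ 2)) <= 6000 * b%:R ^+ 2 * q%:R :> R.
Proof.
set m := (k %/ _)%N; set M := Num.max 1 _ => b_ge2 m_large fits T_tolerant.
have M_ge1 : 1 <= M by rewrite le_max lexx.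
have M_ge : ln (k%:R ^+ 2) <= M by rewrite le_max lexx orbT.
have b_ge : 2 <= b%:R :> R by rewrite ler_nat.
have k2_ge0 : 0 <= k%:R ^+ 2 :> R by rewrite exprn_ge0.
rewrite ler_pdivrMr; last by lra.
have [k2_lt|q_le] := ltnP (k ^ 2) q.
  have : k%:R ^+ 2 <= q%:R :> R by rewrite -natrX ler_nat ltnW.
  have : 1 <= 6000 * b%:R ^+ 2 * M by nra.
  by rewrite mulrAC; nra.
have k_eq := divn_eq k (2 * b).-1; rewrite -/m in k_eq.
have rem_lt : (k %% (2 * b).-1 < (2 * b).-1)%N by rewrite ltn_pmod //; lia.
have k_le : (k <= 2 * b * m)%N by nia.
have k_gt1 : (1 < k)%N by nia.
pose t := (7 + 4 * up_log 2 k)%N.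
have t_le : t%:R <= 15 * M :> R.
  by have := up_log2_le R k_gt1; rewrite natrD natrM; lra.
have q2_le : (128 * q ^ 2 <= 2 ^ t)%N.
  have /andP[_ k_exp] := up_log_bounds (isT : (1 < 2)%N) k_gt1.
  rewrite expnD leq_mul // mulnC expnM; apply: (@leq_trans ((k ^ 2) ^ 2)).
    by rewrite leq_exp2r.
  by rewrite -expnM leq_exp2r.
have m2_lt : (m ^ 2 < 100 * (q * t))%N.
  by apply: (junta_tester_queries_gt (b := b) (r := (2 * b).-2)
    _ fits _ _ _ T_tolerant q2_le); nia.
have k2_le : k%:R ^+ 2 <= (2 * b%:R * m%:R) ^+ 2 :> R.
  by rewrite ler_pXn2r ?nnegrE ?mulr_ge0 // -!natrM ler_nat.
have qt_le : q%:R * t%:R <= q%:R * (15 * M) :> R by rewrite ler_wpM2l.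
have m2_le : m%:R ^+ 2 <= 100 * (q%:R * (15 * M)).
  by move: m2_lt; rewrite -(ltr_nat R) !natrM; lra.
apply: le_trans k2_le _; rewrite exprMn.
have b2_gt0 : 0 < (2 * b%:R) ^+ 2 :> R by rewrite exprn_gt0 //; lra.
rewrite -(ler_pM2l b2_gt0) in m2_le; lra.
Qed.

Lemma junta_tester_lower_bound (R : realType) (b n k q : nat)
    (T : nonadaptive_tester R n q) :
  (2 <= b)%N -> (k < n)%N -> (2 * b * (k %/ (2 * b).-1) <= n)%N ->
  is_tolerant_tester (1 / 4) (5 / 16) (juntas n k) T ->
  k%:R ^+ 2 / Num.max 1 (ln (k%:R ^+ 2)) <=
  (6000 * b%:R ^+ 2 + (200 * b * (2 * b + 13))%:R ^+ 2) * q%:R :> R.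
Proof.
set K := (200 * b * _)%N => b_ge2 k_lt_n fits T_tolerant.
have q_ge1 : 1 <= q%:R :> R.
  rewrite ler1n.
  apply: (tolerant_tester_queries_gt0 T_tolerant (f := [ffun=> false])).
    by apply: le_trans (dist_class_mem R (cst_junta n k false)) _; lra.
  by apply: parity_far k_lt_n _; lra.
have [k_small|k_large] := ltnP k K; last first.
  apply: le_trans (junta_tester_lower_bound_large b_ge2 _ fits T_tolerant) _.
    by rewrite leq_divRL; [rewrite /K in k_large; nia|lia].
  by rewrite ler_wpM2r // lerDl exprn_ge0.
have M_ge1 : 1 <= Num.max 1 (ln (k%:R ^+ 2)) :> R by rewrite le_max lexx.
apply: (@le_trans _ _ (k%:R ^+ 2)).
  by rewrite ler_pdivrMr ?(lt_le_trans _ M_ge1) // ler_peMr ?exprn_ge0.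
have : k%:R ^+ 2 <= K%:R ^+ 2 :> R by rewrite ler_pXn2r ?nnegrE // ler_nat ltnW.
have : 0 <= b%:R ^+ 2 :> R by rewrite exprn_ge0.
have : 0 <= K%:R ^+ 2 :> R by rewrite exprn_ge0.
nra.
Qed.

Lemma exists_block_size (R : archiRealFieldType) (alpha : R) :
  alpha < 1 -> exists2 b : nat, (2 <= b)%N & 1 <= 2 * b%:R * (1 - alpha).
Proof.
move=> alpha_lt1; have gap_gt0 : 0 < 1 - alpha by rewrite subr_gt0.
exists (Num.bound ((1 - alpha)^-1)).+2 => //.
have inv_ge0 : 0 <= (1 - alpha)^-1 by rewrite invr_ge0 ltW.
have := ltW (archi_boundP inv_ge0).
rewrite -[X in X <= _]mul1r ler_pdivrMr // => bound_ge.
rewrite -[_.+2]addn2 natrD.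
have : 0 <= (Num.bound (1 - alpha)^-1)%:R :> R by [].
nra.
Qed.

Lemma blocks_fit (R : realFieldType) (alpha : R) (b n k : nat) :
  (2 <= b)%N -> 1 <= 2 * b%:R * (1 - alpha) -> k%:R <= alpha * n%:R ->
  (2 * b * (k %/ (2 * b).-1) <= n)%N.
Proof.
move=> b_ge2 b_alpha k_le.
have := leq_divM k (2 * b).-1; set m := (k %/ _)%N => m_le.
have b_ge : 2 <= b%:R :> R by rewrite ler_nat.
have pred_gt0 : 0 < 2 * b%:R - 1 :> R by lra.
have m_leR : m%:R * (2 * b%:R - 1) <= k%:R :> R.
  have -> : 2 * b%:R - 1 = (2 * b).-1%:R :> R.
    by rewrite -[(2 * b).-1]subn1 natrB ?natrM //; lia.
  by rewrite -natrM ler_nat.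
rewrite -(ler_nat R) !natrM -(ler_pM2l pred_gt0).
have : 2 * b%:R * (m%:R * (2 * b%:R - 1)) <= 2 * b%:R * (alpha * n%:R).
  by rewrite ler_pM2l; [exact: le_trans m_leR k_le|lra].
have : n%:R <= 2 * b%:R * (1 - alpha) * n%:R by rewrite ler_peMl.
lra.
Qed.

Theorem theorem1p3 (R : realType) :
  exists c : nat,
  forall alpha : R, alpha < 1 ->
  exists eps0 eps1 : R,
    [/\ 0 < eps0, eps0 < eps1, eps1 < 1 &
    exists (C : R) (n0 : nat), 0 < C /\
      forall n k : nat, (n0 <= n)%N -> k%:R <= alpha * n%:R ->
      forall (q : nat) (T : nonadaptive_tester R n q),
        is_tolerant_tester eps0 eps1 (juntas n k) T ->
        C * over_polylog c ((k%:R : R) ^+ 2) <= q%:R].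
Proof.
exists 1%N => alpha alpha_lt1; exists (1 / 4), (5 / 16); split; try lra.
have [b b_ge2 b_alpha] := exists_block_size alpha_lt1.
pose D : R := 6000 * b%:R ^+ 2 + (200 * b * (2 * b + 13))%:R ^+ 2.
have D_gt0 : 0 < D.
  by rewrite ltr_pwDl ?exprn_ge0 // mulr_gt0 ?exprn_gt0 // ltr0n ltnW.
exists D^-1, 1%N; split=> [|n k n_gt0 k_le q T T_tolerant].
  by rewrite invr_gt0.
have k_lt_n : (k < n)%N.
  by rewrite -(ltr_nat R) (le_lt_trans k_le) // gtr_pMl ?ltr0n.
rewrite /over_polylog expr1 ler_pdivrMl //.
have fits := blocks_fit b_ge2 b_alpha k_le.
exact: junta_tester_lower_bound b_ge2 k_lt_n fits T_tolerant.
Qed.
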